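(* There is a polynomial-time algorithm that, given a general matroid $M_1=(X,\mathcal{I}_1)$ (accessed through an independence oracle) and $k-1$ partition matroids $M_2=(X,\mathcal{I}_2),\ldots,M_k=(X,\mathcal{I}_k)$ on the same finite ground set $X$, produces a coloring of the intersection $M=\bigcap_{i=1}^k M_i$ using at most $1+\sum_{i=1}^k\left(\chi(M_i)-1\right)$ colors.
   Context: A partition matroid on $X$ is given by a partition $X=X_1\cup\cdots\cup X_m$ and capacities $d_1,\ldots,d_m$ (positive integers); a set $I\subseteq X$ is independent iff $|I\cap X_j|\le d_j$ for all $j$. The intersection $M=\bigcap_{i=1}^k M_i$ is the set system $(X,\bigcap_{i=1}^k\mathcal{I}_i)$. A coloring of a set system $(X,\mathcal{J})$ is an assignment of a color to every element of $X$ such that each color class belongs to $\mathcal{J}$. For a set system $N$, $\chi(N)$ denotes its chromatic number, the minimum number of colors in such a coloring. *)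

(* Defs.v *)
From HB Require Import structures.
From mathcomp Require Import all_boot all_order all_algebra.

Set Implicit Arguments.
Unset Strict Implicit.
Unset Printing Implicit Defensive.

(** * Set systems, colorings, matroids *)

Section SetSystems.
Variable X : finType.
Implicit Type J : {set {set X}}.

Definition is_coloring J (C : eqType) (f : X -> C) : bool :=
  [forall x, [set y | f y == f x] \in J].

Definition num_colors (C : eqType) (f : X -> C) : nat := size (undup (codom f)).

Definition colorable J (c : nat) : bool :=
  [exists f : {ffun X -> 'I_c}, is_coloring J f].

(* More than #|X| colors are never needed, so the minimum is taken over
   c <= #|X| (see [chiP]).  The value is meaningless if J has no coloring. *)
Definition chi J : nat :=
  [arg min_(c < (ord_max : 'I_#|X|.+1) | colorable J c) (c : nat)].

Definition is_matroid J : Prop :=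
  [/\ set0 \in J,
      (forall A B : {set X}, A \subset B -> B \in J -> A \in J)
    & (forall A B : {set X}, A \in J -> B \in J -> #|A| < #|B| ->
        exists2 x, x \in B :\: A & x |: A \in J)].

Lemma colorable_card J c : colorable J c -> colorable J #|X|.
Proof.
case/existsP=> f /forallP fP.
pose r x := odflt x [pick y | f y == f x].
have frE x : f (r x) = f x.
  by rewrite /r; case: pickP => [y /eqP|/(_ x)] //=; rewrite eqxx.
have rE x y : (r x == r y) = (f x == f y).
  apply/eqP/eqP => [e|e]; first by rewrite -(frE x) e frE.
  rewrite /r e; case: pickP => [//|/(_ y)]; by rewrite eqxx.
apply/existsP; exists [ffun x => enum_rank (r x)]; apply/forallP => x.
suff -> : [set y | [ffun x => enum_rank (r x)] y == [ffun x => enum_rank (r x)] x]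
          = [set y | f y == f x] by apply: fP.
by apply/setP => y; rewrite !inE !ffunE (inj_eq enum_rank_inj) rE.
Qed.

Lemma chiP J c : colorable J c -> colorable J (chi J) /\ chi J <= c.
Proof.
move=> Jc; have JX := colorable_card Jc.
rewrite /chi; case: arg_minnP => // m Jm mP; split=> //.
have [lecX|ltXc] := leqP c #|X|; first exact: (mP (Ordinal (lecX : c < #|X|.+1))).
by apply: leq_trans (ltnW ltXc); rewrite -ltnS ltn_ord.
Qed.

End SetSystems.

(** * Partition matroids on 'I_n *)

(* The partition is given by the part label of each element. *)
Record partition_matroid (n : nat) := PartitionMatroid {
  nparts : nat;
  part_of : 'I_n -> 'I_nparts;
  capacity : 'I_nparts -> nat;
  capacity_gt0 : forall j, 0 < capacity j }.

Definition pm_part n (M : partition_matroid n) (j : 'I_(nparts M)) : {set 'I_n} :=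
  [set x | part_of M x == j].

Definition pm_indep n (M : partition_matroid n) : {set {set 'I_n}} :=
  [set I : {set 'I_n} | [forall j : 'I_(nparts M), #|I :&: pm_part j| <= capacity j]].

(* The family M_1, ..., M_k with k = q.+1, indexed from 0. *)
Definition systems n q (I1 : {set {set 'I_n}}) (P : 'I_q -> partition_matroid n)
    (i : 'I_q.+1) : {set {set 'I_n}} :=
  if unlift ord0 i is Some j then pm_indep (P j) else I1.

(** * Oracle programs *)

(* A random access machine presented as a while language: scalar variables and
   two-dimensional arrays, both named by numbers, hold natural numbers of
   arbitrary size.  Every assignment, test and oracle query takes one step.  The
   arithmetic operations are limited to addition and truncated subtraction (no
   multiplication), so that bit lengths grow by O(1) per step and the unit cost
   measure is polynomially related to Turing machine time. *)

Inductive expr : Type :=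
| Const of nat
| Var of nat
| Read of nat & expr & expr
| Add of expr & expr
| Sub of expr & expr
| EqTest of expr & expr
| LtTest of expr & expr.

Inductive cmd : Type :=
| Skip
| Assign of nat & expr
| Write of nat & expr & expr & expr
| Query of nat & nat & expr
| Seq of cmd & cmd
| If of expr & cmd & cmd
| While of expr & cmd.

Record state := State { var : nat -> nat; arr : nat -> nat -> nat -> nat }.

Definition set_var (s : state) (v a : nat) : state :=
  State (fun w => if w == v then a else var s w) (arr s).

Definition set_arr (s : state) (b i j a : nat) : state :=
  State (var s) (fun b' i' j' =>
    if [&& b' == b, i' == i & j' == j] then a else arr s b' i' j').

Fixpoint eval (s : state) (e : expr) : nat :=
  match e with
  | Const a => a
  | Var v => var s v
  | Read b e1 e2 => arr s b (eval s e1) (eval s e2)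
  | Add e1 e2 => eval s e1 + eval s e2
  | Sub e1 e2 => eval s e1 - eval s e2
  | EqTest e1 e2 => eval s e1 == eval s e2
  | LtTest e1 e2 => eval s e1 < eval s e2
  end.

(* The subset of 'I_n whose indicator function is row i of array b. *)
Definition row_set n (s : state) (b i : nat) : {set 'I_n} :=
  [set x : 'I_n | arr s b i x != 0].

(* [exec O c s s' t]: with oracle O, command c started in state s halts in state
   s' after exactly t steps. *)
Inductive exec n (O : pred {set 'I_n}) : cmd -> state -> state -> nat -> Prop :=
| ExecSkip s : exec O Skip s s 1
| ExecAssign s v e : exec O (Assign v e) s (set_var s v (eval s e)) 1
| ExecWrite s b e1 e2 e :
    exec O (Write b e1 e2 e) s (set_arr s b (eval s e1) (eval s e2) (eval s e)) 1
| ExecQuery s v b e :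
    exec O (Query v b e) s (set_var s v (O (row_set n s b (eval s e)))) 1
| ExecSeq c1 c2 s s1 s2 t1 t2 :
    exec O c1 s s1 t1 -> exec O c2 s1 s2 t2 -> exec O (Seq c1 c2) s s2 (t1 + t2)
| ExecIfTrue e c1 c2 s s' t :
    eval s e != 0 -> exec O c1 s s' t -> exec O (If e c1 c2) s s' t.+1
| ExecIfFalse e c1 c2 s s' t :
    eval s e == 0 -> exec O c2 s s' t -> exec O (If e c1 c2) s s' t.+1
| ExecWhileTrue e c s s1 s2 t1 t2 :
    eval s e != 0 -> exec O c s s1 t1 -> exec O (While e c) s1 s2 t2 ->
    exec O (While e c) s s2 (t1 + t2).+1
| ExecWhileFalse e c s : eval s e == 0 -> exec O (While e c) s s 1.

Lemma exec_det n (O : pred {set 'I_n}) c s s1 s2 t1 t2 :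
  exec O c s s1 t1 -> exec O c s s2 t2 -> s1 = s2 /\ t1 = t2.
Proof.
move=> H; elim: H s2 t2 => {c s s1 t1};
  intros; match goal with K : exec _ _ _ _ _ |- _ =>
    solve [inversion K; subst; repeat (match goal with
      | E : is_true (?b != 0), F : is_true (?b == 0) |- _ =>
          by move: E; rewrite F
      | IH : forall s t, exec ?O ?c ?s0 s t -> _, E : exec ?O ?c ?s0 _ _ |- _ =>
          case: (IH _ _ E) => ? ?; clear IH; subst
      end); by []] end.
Qed.

(** * Input and output conventions *)

Definition at_ord (m : nat) (f : 'I_m -> nat) (i : nat) : nat :=
  oapp f 0 (insub i).

(* Variables: 0 holds n and 1 holds the number q of partition matroids.
   Arrays, for i < q: 0[i][x] is the label of the part of the i-th partition
   matroid containing x, 1[i][j] is the capacity of its part j, 2[0][i] is its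
   number of parts.  Everything else is 0; in particular nothing about the
   general matroid is available except through the oracle. *)
Definition input_state n q (P : 'I_q -> partition_matroid n) : state :=
  State
    (fun v => match v with 0 => n | 1 => q | _ => 0 end)
    (fun b i j => match b with
       | 0 => at_ord (fun i' => at_ord (fun x => part_of (P i') x : nat) j) i
       | 1 => at_ord (fun i' => at_ord (@capacity _ (P i')) j) i
       | 2 => if i == 0 then at_ord (fun j' => nparts (P j')) j else 0
       | _ => 0
       end).

(* The color of x is the final content of 3[0][x]. *)
Definition output_coloring n (s : state) (x : 'I_n) : nat := arr s 3 0 x.

Definition bits (a : nat) : nat := (trunc_log 2 a).+1.

(* Encoding length: n and q in unary, labels and capacities in binary. *)
Definition input_size n q (P : 'I_q -> partition_matroid n) : nat :=
  n + q + \sum_(i < q) (\sum_(x < n) bits (part_of (P i) x)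
                        + \sum_(j < nparts (P i)) bits (capacity j)).

(* Main.v *)
Require Import Defs.
From mathcomp Require Import all_boot all_order all_algebra.
From mathcomp Require Import zify.

(* A coloring f of M_1 with chi(M_1) classes is computed first, then color
   classes of the intersection are split off one per round.  In a round, I
   starts empty and the classes A_1, A_2, ... of f are scanned.  Let W be what
   is left in class t - 1 after it was scanned; W and I are disjoint and I + W
   is independent.  By the multiple exchange property A_t = R1 + R2 with I + R1
   and W + R2 independent.  R2 is moved down to class t - 1, a maximal part of R1
   that is compatible with the partition matroids joins I, and the rest of R1 is
   the new W.  At t = 1 there is no class to move to, and R1 = A_1.  Thus every
   element that is not colored in the round either has f decreased, or lies in a
   part of some partition matroid that I saturates.  Saturating the part X_j of
   M_i uses up d_j of its at most chi(M_i) d_j elements, so an element that is still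
   uncolored has seen this at most chi(M_i) - 1 times for each i.

   The coloring f and the splits R1 + R2 are both found by inserting elements one
   by one, as in Edmonds' matroid partition algorithm. *)

Set Implicit Arguments.
Unset Strict Implicit.
Unset Printing Implicit Defensive.

(** * Matroid exchange *)

Section Matroid.
Variables (X : finType) (J : {set {set X}}).
Hypothesis matJ : is_matroid J.
Implicit Types A B C D P Q S T : {set X}.

Lemma indep_sub A B : A \subset B -> B \in J -> A \in J.
Proof. by case: matJ => _ sub _; apply: sub. Qed.

(** Repeated exchange: elements of [B] are added to [A] until the size of [B] is reached. *)
Lemma indep_augment A B : A \in J -> B \in J ->
  exists C, [/\ A \subset C, C \subset A :|: B, C \in J & #|B| <= #|C|].
Proof.
have [k] := ubnP (#|B| - #|A|); elim: k A => // k IHk A ltk AJ BJ.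
have [leBA|ltAB] := leqP #|B| #|A|; first by exists A; rewrite subxx subsetUl.
case: matJ => _ _ /(_ A B AJ BJ ltAB) [x]; rewrite inE => /andP[xA xB] xAJ.
have [|C [sC1 sC2 CJ leC]] := IHk (x |: A) _ xAJ BJ.
  by rewrite cardsU1 xA; lia.
exists C; split=> //; first by apply: subset_trans sC1; apply: subsetUr.
apply: subset_trans sC2 _; rewrite subUset subsetUr andbT subUset subsetUl andbT.
by rewrite sub1set inE xB orbT.
Qed.

(** Growing [x |: T] by elements of [D] to size at least [#|D|] cannot use [y], because [T], [x] and
    [y] together are dependent. Only [x |: (D :\ y)] is left. *)
Lemma indep_exchange T D x y : D \in J -> T \subset D -> y \in D ->
  x |: T \in J -> x |: (y |: T) \notin J -> x |: (D :\ y) \in J.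
Proof.
move=> DJ sTD yD xTJ xyTJ.
have yT : y \notin T.
  apply: contra xyTJ => yT; suff -> : y |: T = T by [].
  by apply/setUidPr; rewrite sub1set.
have xT : x \notin T.
  apply: contra xyTJ => xT; apply: indep_sub DJ.
  by rewrite !subUset !sub1set yD sTD (subsetP sTD).
have [C [sC1 sC2 CJ leC]] := indep_augment xTJ DJ.
have yC : y \notin C.
  apply: contra xyTJ => yC; apply: indep_sub CJ.
  by rewrite setUCA subUset sub1set yC.
suff -> : x |: D :\ y = C by [].
apply/eqP; rewrite eq_sym eqEcard; apply/andP; split.
  apply/subsetP => z zC; have := subsetP sC2 _ zC; rewrite !inE.
  have -> : z != y by apply: contraNneq yC => <-.
  case: (z == x) => //=; case zT : (z \in T) => //= _; exact: (subsetP sTD).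
apply: leq_trans leC; rewrite (cardsD1 y D) yD.
by apply: leq_trans (leq_card_setU _ _) _; rewrite cards1.
Qed.

(** No element of [P :|: S] extends [P :|: A], so the exchange axiom forbids a larger independent
    set inside [P :|: S]. *)
Lemma stuck_max P A S D : P :|: A \in J ->
  (forall y, y \in S -> y \notin A -> y |: (P :|: A) \notin J) ->
  D \subset P :|: S -> D \in J -> #|D| <= #|P :|: A|.
Proof.
move=> PAJ stuck sD DJ; rewrite leqNgt; apply/negP => lt.
case: matJ => _ _ /(_ _ _ PAJ DJ lt) [x]; rewrite !inE negb_or -andbA.
case/and3P=> xP xA xD; apply/negP; apply: stuck => //.
by have := subsetP sD _ xD; rewrite inE (negbTE xP).
Qed.

(* Submodularity of the rank, applied to an independent set D with
   S <= D <= P + Q + S and at least |P| + |Q| elements. *)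
Lemma stuck_split P Q A B S : P :|: Q \in J -> [disjoint P & Q] ->
  [disjoint P & S] -> [disjoint Q & S] -> S \in J ->
  P :|: A \in J -> Q :|: B \in J ->
  (forall y, y \in S -> y \notin A -> y |: (P :|: A) \notin J) ->
  (forall y, y \in S -> y \notin B -> y |: (Q :|: B) \notin J) ->
  #|S| <= #|A| + #|B|.
Proof.
move=> PQJ dPQ dPS dQS SJ PAJ QBJ stA stB.
have [D [sD1 sD2 DJ leD]] := indep_augment SJ PQJ.
have D1 : #|D :&: (P :|: S)| <= #|P| + #|A|.
  apply: leq_trans (leq_card_setU _ _); apply: stuck_max stA _ _ => //.
    exact: subsetIr.
  by apply: indep_sub DJ; apply: subsetIl.
have D2 : #|D :&: (Q :|: S)| <= #|Q| + #|B|.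
  apply: leq_trans (leq_card_setU _ _); apply: stuck_max stB _ _ => //.
    exact: subsetIr.
  by apply: indep_sub DJ; apply: subsetIl.
have cPQ : #|P :|: Q| = #|P| + #|Q| by apply/eqP; rewrite (leq_card_setU P Q).2.
have E := cardsUI (D :&: (P :|: S)) (D :&: (Q :|: S)).
have E1 : D :&: (P :|: S) :|: D :&: (Q :|: S) = D.
  rewrite -setIUr; apply/setIidPl; apply: subset_trans sD2 _.
  by apply/subsetP => z; rewrite !inE; case: (z \in S); case: (z \in P); case: (z \in Q).
have E2 : D :&: (P :|: S) :&: (D :&: (Q :|: S)) = S.
  apply/setP => z; rewrite !inE.
  case zS: (z \in S); first by rewrite (subsetP sD1) ?zS // !orbT.
  rewrite !orbF; case: (z \in D) => //=.
  by apply/negbTE/negP => /andP[zP]; apply/negP; rewrite (disjointFr dPQ zP).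
rewrite E1 E2 in E; lia.
Qed.

End Matroid.

(** * Total correctness with time bounds *)

(** With [moda], a syntactic over-approximation of the registers that a command may change;
    [exec_agree] turns it into a frame rule. *)
Fixpoint modv (c : cmd) : seq nat :=
  match c with
  | Assign v _ | Query v _ _ => [:: v]
  | Seq c1 c2 | If _ c1 c2 => modv c1 ++ modv c2
  | While _ c => modv c
  | _ => [::]
  end.

Fixpoint moda (c : cmd) : seq nat :=
  match c with
  | Write b _ _ _ => [:: b]
  | Seq c1 c2 | If _ c1 c2 => moda c1 ++ moda c2
  | While _ c => moda c
  | _ => [::]
  end.

Definition agree (vs bs : seq nat) (s s' : state) : Prop :=
  (forall v, v \notin vs -> var s' v = var s v) /\
  (forall b, b \notin bs -> arr s' b = arr s b).

Lemma agree_trans vs bs s1 s2 s3 :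
  agree vs bs s1 s2 -> agree vs bs s2 s3 -> agree vs bs s1 s3.
Proof.
by move=> [v1 b1] [v2 b2]; split=> [v|b] H; rewrite ?v2 ?b2 ?v1 ?b1.
Qed.

Lemma agree_sub vs bs vs' bs' s s' : {subset vs <= vs'} -> {subset bs <= bs'} ->
  agree vs bs s s' -> agree vs' bs' s s'.
Proof.
by move=> sv sb [Hv Hb]; split=> x xN; [apply: Hv|apply: Hb]; apply: contra xN; auto.
Qed.

Lemma agree_set_var v vs bs s a : v \in vs -> agree vs bs s (set_var s v a).
Proof. by move=> vin; split=> // w /=; case: eqP => // ->; rewrite vin. Qed.

Section WP.
Variables (n : nat) (O : pred {set 'I_n}).
Implicit Types (c : cmd) (Q : state -> Prop) (s : state).

Lemma exec_agree c s s' t : exec O c s s' t -> agree (modv c) (moda c) s s'.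
Proof.
elim=> {c s s' t} //=.
- by move=> s v e; apply: agree_set_var; rewrite inE.
- by move=> s b e1 e2 e; split=> // b'; rewrite inE /= => /negbTE ->.
- by move=> s v b e; apply: agree_set_var; rewrite inE.
- move=> c1 c2 s s1 s2 t1 t2 _ A1 _ A2.
  by apply: (agree_trans (s2 := s1));
    [apply: agree_sub A1|apply: agree_sub A2] => x xin; rewrite mem_cat xin ?orbT.
- by move=> e c1 c2 s s' t _ _; apply: agree_sub => x xin; rewrite mem_cat xin.
- by move=> e c1 c2 s s' t _ _; apply: agree_sub => x xin; rewrite mem_cat xin orbT.
- by move=> e c s s1 s2 t1 t2 _ _ A1 _; apply: agree_trans.
Qed.

(** Total correctness: [T] is an upper bound on the steps, whereas [exec] counts them exactly. *)
Definition wp c (T : nat) Q s : Prop :=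
  exists s' t, [/\ exec O c s s' t, t <= T & Q s'].

Lemma wp_conseq c T T' Q Q' s : wp c T Q s -> T <= T' ->
  (forall s', agree (modv c) (moda c) s s' -> Q s' -> Q' s') -> wp c T' Q' s.
Proof.
move=> [s' [t [E le q]]] leT H; exists s', t; split=> //.
  exact: leq_trans leT.
by apply: H q; apply: exec_agree E.
Qed.

Lemma wp_time c T T' Q s : wp c T Q s -> T <= T' -> wp c T' Q s.
Proof. by move=> H le; apply: wp_conseq H le _. Qed.

Lemma wp_post c T Q Q' s : wp c T Q s ->
  (forall s', agree (modv c) (moda c) s s' -> Q s' -> Q' s') -> wp c T Q' s.
Proof. by move=> H; apply: wp_conseq H _. Qed.

Lemma wp_skip Q s : Q s -> wp Skip 1 Q s.
Proof. by exists s, 1; split=> //; constructor. Qed.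

Lemma wp_assign v e Q s : Q (set_var s v (eval s e)) -> wp (Assign v e) 1 Q s.
Proof. by move=> q; do 2!eexists; split; [constructor| |exact: q]. Qed.

Lemma wp_write b e1 e2 e Q s :
  Q (set_arr s b (eval s e1) (eval s e2) (eval s e)) -> wp (Write b e1 e2 e) 1 Q s.
Proof. by move=> q; do 2!eexists; split; [constructor| |exact: q]. Qed.

Lemma wp_query v b e Q s :
  Q (set_var s v (O (row_set n s b (eval s e)))) -> wp (Query v b e) 1 Q s.
Proof. by move=> q; do 2!eexists; split; [constructor| |exact: q]. Qed.

Lemma wp_seq c1 c2 T1 T2 Q s : wp c1 T1 (wp c2 T2 Q) s -> wp (Seq c1 c2) (T1 + T2) Q s.
Proof.
case=> s1 [t1 [E1 le1 [s2 [t2 [E2 le2 q]]]]]; exists s2, (t1 + t2); split=> //.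
  exact: ExecSeq E1 E2.
exact: leq_add.
Qed.

Lemma wp_if e c1 c2 T1 T2 Q s :
  (eval s e != 0 -> wp c1 T1 Q s) -> (eval s e = 0 -> wp c2 T2 Q s) ->
  wp (If e c1 c2) (T1 + T2).+1 Q s.
Proof.
move=> H1 H2; have [z|nz] := eqVneq (eval s e) 0.
  have [s' [t [E le q]]] := H2 z; exists s', t.+1; split=> //; last by lia.
  by apply: ExecIfFalse E; apply/eqP.
have [s' [t [E le q]]] := H1 nz; exists s', t.+1; split=> //; last by lia.
exact: ExecIfTrue E.
Qed.

(** [mu] bounds the remaining iterations. Each costs the body and one test; the failing test costs
    one more step. *)
Lemma wp_while (Inv : state -> Prop) (mu : state -> nat) T b e c Q s0 :
  Inv s0 -> mu s0 <= b ->
  (forall s, agree (modv c) (moda c) s0 s -> Inv s -> eval s e != 0 ->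
     wp c T (fun s' => Inv s' /\ mu s' < mu s) s) ->
  (forall s, agree (modv c) (moda c) s0 s -> Inv s -> eval s e = 0 -> Q s) ->
  wp (While e c) (b * T.+1).+1 Q s0.
Proof.
move=> I0 leb step fin.
suff loop s : Inv s -> mu s <= b -> agree (modv c) (moda c) s0 s ->
  wp (While e c) (b * T.+1).+1 Q s by apply: loop.
elim: b s {leb} => [|b IHb] s Is leb As.
  have [z|nz] := eqVneq (eval s e) 0.
    exists s, 1; split=> //; last exact: fin.
    by apply: ExecWhileFalse; apply/eqP.
  by have [s' [t [_ _ [_ lt]]]] := step s As Is nz; lia.
have [z|nz] := eqVneq (eval s e) 0.
  exists s, 1; split=> //; last exact: fin.
    by apply: ExecWhileFalse; apply/eqP.
have [s' [t [E le [Is' lt]]]] := step s As Is nz.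
have As' : agree (modv c) (moda c) s0 s' by apply: agree_trans As (exec_agree E).
have [|s2 [t2 [E2 le2 q]]] := IHb s' Is' _ As'; first by lia.
exists s2, (t + t2).+1; split=> //; last by rewrite mulSn; lia.
exact: ExecWhileTrue E E2.
Qed.

Definition For v lo hi c : cmd :=
  Seq (Assign v lo)
      (While (LtTest (Var v) hi) (Seq c (Assign v (Add (Var v) (Const 1))))).

(** [hi] is evaluated anew at every test, so it must keep the value [b]. An iteration costs [T] plus
    test and increment; the final 2 counts the initialization and the failing test. *)
Lemma wp_for (Inv : nat -> state -> Prop) T a b v lo hi c Q s0 :
  v \notin modv c -> eval s0 lo = a -> a <= b ->
  (forall s, agree (v :: modv c) (moda c) s0 s -> eval s hi = b) ->
  Inv a (set_var s0 v a) ->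
  (forall i s, agree (v :: modv c) (moda c) s0 s -> a <= i < b -> var s v = i ->
     Inv i s -> wp c T (fun s' => Inv i.+1 (set_var s' v i.+1)) s) ->
  (forall s, agree (v :: modv c) (moda c) s0 s -> Inv b s -> Q s) ->
  wp (For v lo hi c) ((b - a) * T.+2 + 2) Q s0.
Proof.
move=> vc ea leab ehi I0 step fin.
have mE : {subset modv c ++ [:: v] <= v :: modv c}.
  by move=> x; rewrite mem_cat !inE orbC.
have mA : {subset moda c ++ [::] <= moda c} by move=> x; rewrite cats0.
have A0 : agree (v :: modv c) (moda c) s0 (set_var s0 v a).
  by apply: agree_set_var; rewrite inE eqxx.
have up s : agree (modv c ++ [:: v]) (moda c ++ [::]) (set_var s0 v a) s ->
  agree (v :: modv c) (moda c) s0 s.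
  by move=> A1; apply: agree_trans A0 _; apply: agree_sub A1.
apply: (wp_time (T := 1 + ((b - a) * (T + 1).+1).+1)); last by lia.
apply/wp_seq/wp_assign; rewrite ea.
apply: (wp_while (Inv := fun s => a <= var s v <= b /\ Inv (var s v) s)
                 (mu := fun s => b - var s v)).
- by rewrite /= eqxx leqnn leab.
- by rewrite /= eqxx.
- move=> s /= /up As [/andP[l1 l2] Is]; rewrite (ehi _ As) => lt.
  have {}lt : var s v < b by move: lt; case: ltnP.
  apply: wp_seq; apply: wp_post (step (var s v) s As _ erefl Is) _.
    by rewrite l1.
  move=> s' A' Is'; apply: wp_assign; rewrite /= A'.1 // addn1 /= eqxx.
  split; last by lia.
  by split=> //; lia.
- move=> s /= /up As [/andP[l1 l2] Is]; rewrite (ehi _ As) => lt.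
  have E : var s v = b by move: lt; case: ltnP => //; lia.
  by apply: fin => //; rewrite -E.
Qed.

End WP.

(** * Inserting an element into a partition into independent sets *)

Definition upd (f : nat -> nat) (a b : nat) : nat -> nat :=
  fun x => if x == a then b else f x.

Section Insertion.
Variables (n : nat) (J : {set {set 'I_n}}).
Hypothesis matJ : is_matroid J.
Variable fx : nat -> nat -> nat.
Implicit Types (cls pos oc ord : nat -> nat).

(* Class c consists of a fixed set, with indicator function fx c, and of the
   elements y with cls y = c.  Classes are numbered from 1; cls y = 0 means that y
   is in no class. *)
Definition class cls c : {set 'I_n} := [set y : 'I_n | (fx c y != 0) || (cls y == c)].

(** What is left of class [c] after the first [g] removals; the fixed set is never removed. *)
Definition tail cls pos c g : {set 'I_n} :=
  [set y : 'I_n | (fx c y != 0) || (cls y == c) && (g < pos y)].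

Definition tailU1 cls pos c g z : {set 'I_n} :=
  [set y : 'I_n | [|| fx c y != 0, (cls y == c) && (g < pos y) | y == z :> nat]].

(** At the threshold [g] where adding [z] becomes dependent, the tail gains just one element, the
    [y] removed at step [g]. By [indep_exchange], [z] can replace [y] in every independent set
    containing the tail at [g.-1]. *)
Lemma tail_exchange cls pos c g z : z < n -> 0 < g ->
  (forall y y' : 'I_n, pos y = g -> pos y' = g -> y = y') ->
  tailU1 cls pos c g z \in J -> tailU1 cls pos c g.-1 z \notin J ->
  exists y : 'I_n, [/\ pos y = g, cls y = c, fx c y = 0, y != z :> nat &
    forall D : {set 'I_n}, D \in J -> tail cls pos c g.-1 \subset D ->
      [set u : 'I_n | (u == z :> nat) || (u != y) && (u \in D)] \in J].
Proof.
move=> zn g0 inj indg depg.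
(* Without such a [y] the two sets [tailU1] at [g] and [g.-1] would coincide. *)
have [y /andP[/andP[/eqP py /eqP cy] fy]|noy] :=
  pickP (fun y : 'I_n => (pos y == g) && (cls y == c) && ~~ ((fx c y != 0) || (y == z :> nat)));
  last first.
  case/negP: depg; suff -> : tailU1 cls pos c g.-1 z = tailU1 cls pos c g z by [].
  apply/setP=> u; rewrite !inE; have := noy u.
  case: (fx c u != 0) => //=; case: (u == z :> nat); rewrite ?orbT //= ?andbT ?orbF.
  by case: (cls u == c); rewrite ?andbT ?andbF //=; case: ltngtP; lia.
case/norP: fy; rewrite negbK => /eqP fy yz; exists y; split=> // D DJ sD.
pose x := Ordinal zn.
have E1 : tailU1 cls pos c g z = x |: tail cls pos c g.
  by apply/setP=> u; rewrite !inE -val_eqE /=; lia.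
have E2 : tailU1 cls pos c g.-1 z = x |: (y |: tail cls pos c g).
  apply/setP=> u; rewrite !inE -!val_eqE /=.
  have [->|ne] := eqVneq u y; first by rewrite cy py; lia.
  have pu : pos u != g by apply: contra_neq ne => /inj; apply.
  have uy : (u : nat) <> y by apply/eqP; rewrite val_eqE.
  lia.
rewrite E1 in indg; rewrite E2 in depg.
have -> : [set u : 'I_n | (u == z :> nat) || (u != y) && (u \in D)] = x |: (D :\ y).
  by apply/setP=> u; rewrite !inE -val_eqE.
have ysub : y |: tail cls pos c g \subset D.
  apply: subset_trans sD; apply/subsetP=> u; rewrite !inE => /orP[/eqP->|].
    by rewrite cy eqxx py prednK // leqnn orbT.
  by case/orP=> [->//|/andP[-> /= lt]]; apply/orP; right; lia.
apply: indep_exchange indg depg => //.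
  by apply: subset_trans ysub; apply: subsetUr.
by apply: (subsetP ysub); rewrite !inE eqxx.
Qed.

Definition witness cls pos oc ord m j :=
  [/\ 0 < oc (ord j) <= m, cls (ord j) != oc (ord j)
    & tailU1 cls pos (oc (ord j)) j.-1 (ord j) \in J].

(* Elements are removed one by one; pos y is the step at which y is removed (n + 1
   if it is not), ord inverts pos, and oc y is a class c not containing y such that
   y can be added to the elements of c that are not yet removed. *)
Record peeling cls pos oc ord m h : Prop := Peeling {
  peel_pos : forall y : 'I_n, 0 < pos y;
  peel_ord : forall y : 'I_n, pos y <= h -> ord (pos y) = y;
  peel_out : forall y : 'I_n, h < pos y -> n < pos y;
  peel_inv : forall j, 0 < j <= h -> ord j < n /\ pos (ord j) = j;
  peel_witness : forall j, 0 < j <= h -> witness cls pos oc ord m j;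
  peel_card : #|[set y : 'I_n | h < pos y]| + h = n }.

Lemma peeling0 cls pos oc ord m : (forall y : 'I_n, pos y = n.+1) ->
  peeling cls pos oc ord m 0.
Proof.
move=> posE; split=> [y|y|y|j|j|]; rewrite ?posE //; try by lia.
by rewrite addn0 -[RHS]card_ord; apply: eq_card => y; rewrite inE posE.
Qed.

(** Moving [y] to position [h.+1] changes no tail at a threshold [g <= h], so all earlier witnesses
    survive. *)
Lemma peelingS cls pos oc ord m h y c : peeling cls pos oc ord m h ->
  y < n -> h < pos y -> 0 < c <= m -> cls y != c -> tailU1 cls pos c h y \in J ->
  peeling cls (upd pos y h.+1) (upd oc y c) (upd ord h.+1 y) m h.+1.
Proof.
move=> [pP pO pN pI pW pC] yn hy cm cy ty.
have posE g (u : 'I_n) : g <= h -> (g < upd pos y h.+1 u) = (g < pos u).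
  by move=> gh; rewrite /upd; case: eqP => // ->; lia.
have tE cc g z : g <= h -> tailU1 cls (upd pos y h.+1) cc g z = tailU1 cls pos cc g z.
  by move=> gh; apply/setP => u; rewrite !inE posE.
have oy j : 0 < j <= h -> ord j != y.
  by move=> jh; have [_ pj] := pI j jh; apply: contraTneq hy => <-; rewrite pj; lia.
have oE j : j <= h -> upd ord h.+1 y j = ord j by rewrite /upd; case: eqP => //; lia.
have := pC; rewrite (cardsD1 (Ordinal yn)) inE /= hy => pC'.
split.
- by move=> u; rewrite posE.
- move=> u; case: (eqVneq (u : nat) y) => [->|ne]; first by rewrite /upd !eqxx.
  have -> : upd pos y h.+1 u = pos u by rewrite /upd (negbTE ne).
  move=> le.
  (* Unremoved elements have positions above [n], and [h < n] since [y] is unremoved, so position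
     [h.+1] was free. *)
  have le' : pos u <= h by rewrite leqNgt; apply/negP => /pN; lia.
  by rewrite oE // pO.
- by move=> u; rewrite /upd; case: eqP => [_|_ lt]; [lia|apply: pN; lia].
- move=> j jh; case: (eqVneq j h.+1) => [->|ne]; first by rewrite /upd !eqxx.
  have jh' : 0 < j <= h by lia.
  by have [? ?] := pI j jh'; rewrite oE ?/upd ?(negbTE (oy _ jh')); [split|lia].
- move=> j jh; rewrite /witness; case: (eqVneq j h.+1) => [->|ne].
    have -> : upd ord h.+1 y h.+1 = y by rewrite /upd eqxx.
    have -> : upd oc y c y = c by rewrite /upd eqxx.
    by rewrite tE.
  have jh' : 0 < j <= h by lia.
  have [? ? ?] := pW j jh'; rewrite oE; last by lia.
  have -> : upd oc y c (ord j) = oc (ord j) by rewrite /upd (negbTE (oy _ jh')).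
  by rewrite tE //; lia.
- rewrite -[RHS]pC' addnS -addSn -add1n; congr (_ + _ + _).
  apply: eq_card => u; rewrite !inE -val_eqE /= /upd; case: eqP => [_|_ /=]; first by lia.
  by case: (ltnP h (pos u)) => [/pN|]; lia.
Qed.

(* State of the chain of exchanges that started with x: z is the element currently
   without a class.  Only the removals before that of z are still certified. *)
Record shifting cls0 x pos oc ord m cls z : Prop := Shifting {
  shift_lt : z < n;
  shift_cls0 : cls z = 0;
  shift_active : (cls0 z != 0) || (z == x);
  shift_eq0 : forall y : 'I_n, (y != z :> nat) ->
    (cls y == 0) = (cls0 y == 0) && (y != x :> nat);
  shift_le : forall y : 'I_n, cls y <= m;
  shift_class : forall c, 0 < c <= m -> class cls c \in J;
  shift_pos : 0 < pos z;
  shift_ord : ord (pos z) = z;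
  shift_witness : forall j, 0 < j <= pos z -> witness cls pos oc ord m j }.

Definition inserted cls0 x m cls : Prop :=
  [/\ forall y : 'I_n, (cls y == 0) = (cls0 y == 0) && (y != x :> nat),
      forall y : 'I_n, cls y <= m
    & forall c, 0 < c <= m -> class cls c \in J].

(** * One exchange of the chain *)

Section Shift.
Variables (cls0 : nat -> nat) (x : nat) (pos oc ord : nat -> nat) (m h : nat).
Hypothesis peel0 : peeling cls0 pos oc ord m h.
Variables (cls : nat -> nat) (z : nat).
Hypothesis sh : shifting cls0 x pos oc ord m cls z.
Hypothesis zh : pos z <= h.
Let c := oc z.

Let cP : [/\ 0 < c <= m, cls z != c & tailU1 cls pos c (pos z).-1 z \in J].
Proof.
have := shift_witness sh (j := pos z); rewrite /witness (shift_ord sh); apply.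
by rewrite leqnn (shift_pos sh).
Qed.

(** At threshold 0 the tail is all of class [c], positions being positive, so [z] joins it and the
    chain ends. *)
Lemma shift_last : tailU1 cls pos c 0 z \in J -> inserted cls0 x m (upd cls z c).
Proof.
case: cP => cm _ _ tJ; split.
- move=> y; rewrite /upd; case: (eqVneq (y : nat) z) => [->|ne]; last exact: (shift_eq0 sh).
  by have := shift_active sh; lia.
- by move=> y; rewrite /upd; case: eqP => _; [lia|exact: (shift_le sh)].
- move=> c' c'm; have [->|ne] := eqVneq c' c.
    apply: (indep_sub matJ) tJ; apply/subsetP => u; rewrite !inE /upd (peel_pos peel0).
    by case: (eqVneq (u : nat) z) => _; lia.
  apply: (indep_sub matJ) (shift_class sh c'm); apply/subsetP => u; rewrite !inE /upd.
  by case: (eqVneq (u : nat) z) => _; lia.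
Qed.

(** [z] enters [c] and displaces the element removed at step [g]. Since [g < pos z], the chain moves
    to ever earlier removals; certificates after step [g] are given up, and those up to [g]
    survive. *)
Lemma shift_next g : 0 < g < pos z -> tailU1 cls pos c g z \in J ->
  tailU1 cls pos c g.-1 z \notin J ->
  shifting cls0 x pos oc ord m (upd (upd cls z c) (ord g) 0) (ord g)
    /\ pos (ord g) = g.
Proof.
case: cP => cm cz _ gz tJ ntJ.
have inj (y y' : 'I_n) : pos y = g -> pos y' = g -> y = y'.
  move=> py py'; apply: val_inj; rewrite /= -(peel_ord peel0) ?py; last by lia.
  by rewrite -py' (peel_ord peel0) // py'; lia.
have [|y [py cy fy yz ex]] := tail_exchange (shift_lt sh) _ inj tJ ntJ; first by lia.
have oy : ord g = y by rewrite -py (peel_ord peel0) // py; lia.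
rewrite oy; split=> //; set cls' := upd _ _ _.
have c'y : cls' y = 0 by rewrite /cls' /upd eqxx.
have c'z : cls' z = c by rewrite /cls' /upd eq_sym (negbTE yz) eqxx.
have c'E (u : nat) : u != y -> u != z -> cls' u = cls u.
  by rewrite /cls' /upd => /negbTE -> /negbTE ->.
have ycls0 : (cls0 y != 0) || (y == x :> nat).
  by have := shift_eq0 sh yz; rewrite cy; lia.
have sub c' (u : 'I_n) : 0 < c' -> c' != c -> cls' u = c' -> cls u = c'.
  move=> c'0 ne; rewrite /cls' /upd; case: eqP => [_|_]; first by lia.
  by case: eqP => // _ e; rewrite e eqxx in ne.
have subc (u : 'I_n) : cls' u = c -> u != y :> nat /\ (u = z :> nat \/ cls u = c).
  rewrite /cls' /upd; case: eqP => [_|_]; first by lia.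
  by case: eqP => // ? e; split=> //; [left|right].
split=> //.
- move=> u uy; have [->|uz] := eqVneq (u : nat) z.
    by rewrite c'z; have := shift_active sh; lia.
  by rewrite c'E //; apply: (shift_eq0 sh).
- move=> u; rewrite /cls' /upd; case: eqP => // _; case: eqP => _; first by lia.
  exact: (shift_le sh).
- move=> c' c'm; have [->|ne] := eqVneq c' c.
    apply: (indep_sub matJ) (ex _ (shift_class sh cm) _); last first.
      by apply/subsetP => u; rewrite !inE => /orP[->//|/andP[->]]; rewrite orbT.
    apply/subsetP => u; rewrite !inE => /orP[fu|/eqP/subc[uy]].
      rewrite fu orbC /=; apply/orP; left; rewrite andbT.
      by apply: contraNneq fu => ->; rewrite fy.
    by case=> ->; rewrite eqxx ?orbT // -val_eqE uy orbT.
  apply: (indep_sub matJ) (shift_class sh c'm); apply/subsetP => u; rewrite !inE.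
  by case/orP=> [->//|/eqP/sub->]; rewrite ?eqxx ?orbT //; lia.
- by rewrite py; lia.
- by rewrite py.
rewrite py => j jg; have [|ocm occ tj] := shift_witness sh (j := j); first by lia.
have jh : 0 < j <= h by lia.
have [ojn pj] := peel_inv peel0 jh.
have ojz : ord j != z by apply/eqP => e; move: pj; rewrite e; lia.
split=> //.
  have [e|ne] := eqVneq (ord j) y; first by rewrite e c'y; have := ocm; rewrite e; lia.
  by rewrite c'E.
(* A witness set for class [c] at step [j <= g] contains the tail at [g.-1], so [ex] exchanges [y]
   for [z] in it. The other classes gain no element. *)
have [e|ne] := eqVneq (oc (ord j)) c.
  have ojy : ord j != y by apply/eqP => e'; move: occ; rewrite e e' cy eqxx.
  rewrite e in tj *.
  apply: (indep_sub matJ) (ex _ tj _); last first.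
    by apply/subsetP => u; rewrite !inE => /orP[->//|/andP[-> /=]]; lia.
  apply/subsetP => u; rewrite !inE => /or3P[fu|/andP[/eqP/subc[uy]] H pu|/eqP uj].
  - rewrite fu orbC /=; apply/orP; left; rewrite andbT.
    by apply: contraNneq fu => ->; rewrite fy.
  - by case: H => ->; rewrite ?eqxx ?pu ?orbT // -val_eqE uy /= !orbT.
  - by rewrite -val_eqE /= uj ojy eqxx !orbT.
have oc0 : 0 < oc (ord j) by lia.
apply: (indep_sub matJ) tj; apply/subsetP => u; rewrite !inE.
by case/or3P=> [->//|/andP[/eqP/(sub _ _ oc0 ne)-> ->]|->]; rewrite ?eqxx ?orbT.
Qed.

End Shift.

Lemma shifting0 cls0 x pos oc ord m h : peeling cls0 pos oc ord m h ->
  x < n -> cls0 x = 0 -> (forall y : 'I_n, cls0 y <= m) ->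
  (forall c, 0 < c <= m -> class cls0 c \in J) -> pos x <= h ->
  shifting cls0 x pos oc ord m cls0 x.
Proof.
move=> pe xn x0 le cl ph; split=> //.
- by rewrite eqxx orbT.
- by move=> y ->; rewrite andbT.
- exact: (peel_pos pe (Ordinal xn)).
- exact: (peel_ord pe (y := Ordinal xn)).
- by move=> j jh; apply: (peel_witness pe); lia.
Qed.

End Insertion.

(** * The insertion program *)

(* Registers.  Variables: 2 number of classes, 3 element to insert, 7 class c,
   8 step h or g, 9 element y or z, 10 loop index, 11 answer of the oracle,
   12 loop flag, 5 value of h before a pass.
   Arrays (row 0 unless said otherwise): 4 cls, 5[c] fx c, 6 pos, 7 oc, 8 ord,
   9 argument of the oracle. *)
Definition test_cmd : cmd :=
  Seq
    (For 10 (Const 0) (Var 0)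
      (Write 9 (Const 0) (Var 10)
        (Add (Add (Read 5 (Var 7) (Var 10))
                  (LtTest (Const 1)
                     (Add (EqTest (Read 4 (Const 0) (Var 10)) (Var 7))
                          (LtTest (Var 8) (Read 6 (Const 0) (Var 10))))))
             (EqTest (Var 10) (Var 9)))))
    (Query 11 9 (Const 0)).

(** Passes over all pairs of an element and a class are repeated until one removes nothing; then
    every remaining pair has failed its test for the final [h]. *)
Definition peel_cmd : cmd :=
  Seq (For 9 (Const 0) (Var 0)
         (Write 6 (Const 0) (Var 9) (Add (Var 0) (Const 1))))
 (Seq (Assign 8 (Const 0))
 (Seq (Assign 12 (Const 1))
      (While (Var 12)
        (Seq (Assign 5 (Var 8))
        (Seq (For 9 (Const 0) (Var 0)
               (For 7 (Const 1) (Add (Var 2) (Const 1))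
                 (If (EqTest (Read 4 (Const 0) (Var 9)) (Var 7)) Skip
                 (If (LtTest (Var 8) (Read 6 (Const 0) (Var 9)))
                     (Seq test_cmd
                          (If (Var 11)
                             (Seq (Assign 8 (Add (Var 8) (Const 1)))
                             (Seq (Write 6 (Const 0) (Var 9) (Var 8))
                             (Seq (Write 7 (Const 0) (Var 9) (Var 7))
                                  (Write 8 (Const 0) (Var 8) (Var 9)))))
                             Skip))
                     Skip))))
             (Assign 12 (LtTest (Var 5) (Var 8)))))))).

(** The inner loop finds the least [g] for which [z] fits into the tail of class [oc z]. If [g = 0]
    the chain ends; otherwise [ord g] is displaced and becomes the new [z]. *)
Definition shift_cmd : cmd :=
  Seq (Assign 9 (Var 3))
 (Seq (Assign 12 (Const 1))
      (While (Var 12)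
        (Seq (Assign 7 (Read 7 (Const 0) (Var 9)))
        (Seq (Assign 8 (Const 0))
        (Seq test_cmd
        (Seq (While (EqTest (Var 11) (Const 0))
               (Seq (Assign 8 (Add (Var 8) (Const 1))) test_cmd))
        (Seq (Write 4 (Const 0) (Var 9) (Var 7))
             (If (Var 8)
                (Seq (Assign 9 (Read 8 (Const 0) (Var 8)))
                     (Write 4 (Const 0) (Var 9) (Const 0)))
                (Assign 12 (Const 0)))))))))).

Definition insert_cmd : cmd :=
  Seq peel_cmd
      (If (LtTest (Var 8) (Read 6 (Const 0) (Var 3)))
          (Seq (Assign 2 (Add (Var 2) (Const 1)))
               (Write 4 (Const 0) (Var 3) (Var 2)))
          shift_cmd).

Section Insert.
Variables (n : nat) (J : {set {set 'I_n}}).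
Hypothesis matJ : is_matroid J.
Let O : pred {set 'I_n} := fun A => A \in J.

(** In [test_cmd] a sum serves as disjunction and [1 < a + b] as conjunction of two tests, so the
    row given to the oracle is [tailU1]. *)
Lemma wp_test s : var s 0 = n ->
  wp O test_cmd (n * 3 + 3)
    (fun s' => var s' 11 = (tailU1 n (arr s 5) (arr s 4 0) (arr s 6 0)
                              (var s 7) (var s 8) (var s 9) \in J)) s.
Proof.
move=> s0; apply: wp_time.
  apply/wp_seq.
  apply: (@wp_for n O (fun i s' => forall y, y < i -> (arr s' 9 0 y != 0) =
     [|| arr s 5 (var s 7) y != 0, (arr s 4 0 y == var s 7) && (var s 8 < arr s 6 0 y)
       | y == var s 9]) 1 0 n) => //.
  - by move=> s' A; rewrite -s0 /= A.1.
  - move=> i s' A lt iE Inv; apply: wp_write => y /=.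
    rewrite iE ltnS leq_eqVlt; case: eqP => [-> _|_ /= /Inv //].
    by rewrite !A.1 ?A.2 //; lia.
  - move=> s' A Inv; apply: wp_query => /=; rewrite /O.
    suff -> : row_set n s' 9 0 = tailU1 n (arr s 5) (arr s 4 0) (arr s 6 0)
      (var s 7) (var s 8) (var s 9) by [].
    by apply/setP => y; rewrite !inE Inv.
lia.
Qed.

(* The classes restricted to S span S in each of the m contracted matroids, so S is
   a Hall obstruction once it contains an element of no class. *)
Definition stuck (fx : nat -> nat -> nat) (cls : nat -> nat) m (S : {set 'I_n}) : Prop :=
  forall (y : 'I_n) c, y \in S -> 0 < c <= m -> cls y != c ->
    [set u : 'I_n | [|| fx c u != 0, (cls u == c) && (u \in S) | u == y]] \notin J.

Definition time_peel m : nat := (n + 1) * (n * (m * (n * 3 + 15) + 4) + 5) + n * 3 + 5.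

Lemma wp_peel s : var s 0 = n ->
  wp O peel_cmd (time_peel (var s 2))
    (fun s' => let h := var s' 8 in
       peeling J (arr s 5) (arr s 4 0) (arr s' 6 0) (arr s' 7 0) (arr s' 8 0) (var s 2) h
       /\ stuck (arr s 5) (arr s 4 0) (var s 2) [set y : 'I_n | h < arr s' 6 0 y]) s.
Proof.
move=> s0; set m := var s 2; set cls := arr s 4 0; set fx := arr s 5.
apply: wp_time.
  apply/wp_seq.
  apply: (@wp_for n O (fun i s' => forall y, y < i -> arr s' 6 0 y = n.+1) 1 0 n) => //.
  - by move=> s' A; rewrite -s0 /= A.1.
  - move=> i s' A lt iE Inv; apply: wp_write => y /=.
    rewrite iE ltnS leq_eqVlt; case: eqP => [-> _|_ /= /Inv //].
    by rewrite A.1 // s0 addn1.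
  move=> s1 A1 Inv1; apply/wp_seq/wp_assign/wp_seq/wp_assign.
  pose Peel s' := peeling J fx cls (arr s' 6 0) (arr s' 7 0) (arr s' 8 0) m (var s' 8).
  (* Each pass increases [h], which is at most [n], or clears the flag. *)
  apply: (@wp_while n O (fun s' => [/\ Peel s', var s' 12 <= 1 & var s' 12 = 0 ->
      stuck fx cls m [set y : 'I_n | var s' 8 < arr s' 6 0 y]])
      (fun s' => var s' 12 + (n - var s' 8)) _ (n + 1)) => //=.
  - by split=> //; apply: peeling0 => y; rewrite /= Inv1.
  - by lia.
  - move=> s2 A2 [Pe _ _] go.
    have c2 : arr s2 4 0 = cls by rewrite A2.2 //= A1.2.
    have f2 : arr s2 5 = fx by rewrite A2.2 //= A1.2.
    have m2 : var s2 2 = m by rewrite A2.1 //= A1.1.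
    have n2 : var s2 0 = n by rewrite A2.1 //= A1.1.
    apply/wp_seq/wp_assign/wp_seq.
    (* [T] records the pairs rejected in this pass. It is claimed only while [h] is unchanged, since
       a removal shrinks tails and may revive a rejected pair. *)
    pose T i c s' := forall (y : 'I_n) d, (y < i) || (y == i :> nat) && (d < c) ->
      var s' 8 < arr s' 6 0 y -> 0 < d <= m ->
      cls y != d -> tailU1 n fx cls (arr s' 6 0) d (var s' 8) y \notin J.
    pose I i c s' := [/\ Peel s', var s2 8 <= var s' 8 &
      var s' 8 = var s2 8 -> T i c s'].
    apply: (@wp_for n O (fun i => I i 1) _ 0 n) => //.
    - by move=> s' A; rewrite /= A.1.
    - by split=> // _ y d; lia.
    - move=> i s3 A3 iN iE I3.
      apply: (@wp_for n O (fun c s' => I i c s') _ 1 m.+1) => //.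
      + by move=> s' A; rewrite /= A.1 //= A3.1 //= m2 addn1.
      + move=> c s4 A4 cN cE [Pe4 le4 T4].
        have c4 : arr s4 4 0 = cls by rewrite A4.2 //= A3.2.
        have f4 : arr s4 5 = fx by rewrite A4.2 //= A3.2.
        have n4 : var s4 0 = n by rewrite A4.1 //= A3.1.
        have i4 : var s4 9 = i by rewrite A4.1.
        apply: wp_if => /=; rewrite i4 cE c4 => ci.
          apply: wp_skip; split=> // e y d yd; case: (eqVneq d c) => [->|dc].
            have [ltyi|/andP[/eqP yi _]] := orP yd; first by apply: T4 => //; rewrite ltyi.
            by rewrite yi; move: ci; case: (cls i == c).
          by apply: T4 => //; lia.
        apply: wp_if => /=; rewrite i4 => ph; last first.
          apply: wp_skip; split=> // e y d yd; case: (eqVneq d c) => [->|dc].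
            have [ltyi|/andP[/eqP yi _]] := orP yd; first by apply: T4 => //; rewrite ltyi.
            by move: ph; rewrite -yi => ph lt; move: ph; rewrite /= lt.
          by apply: T4 => //; lia.
        apply/wp_seq; apply: wp_post (wp_test n4) _ => s5 A5.
        rewrite f4 c4 cE i4 => r5; apply: wp_if => /=; rewrite r5 => tJ; last first.
          apply: wp_skip; rewrite /I /Peel /T /= A5.1 // !A5.2 //; split=> // e y d yd.
          case: (eqVneq d c) => [->|dc]; last by apply: T4 => //; lia.
          have [ltyi|/andP[/eqP yi _]] := orP yd; first by apply: T4 => //; rewrite ltyi.
          by move=> *; rewrite yi; move: tJ; case: (_ \in J).
        apply/wp_seq/wp_assign/wp_seq/wp_write/wp_seq/wp_write/wp_write.
        have i5 : var s5 9 = i by rewrite A5.1.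
        have c5 : var s5 7 = c by rewrite A5.1.
        have h5 : var s5 8 = var s4 8 by rewrite A5.1.
        split; last by rewrite /= h5; lia.
          rewrite /Peel /= i5 c5 h5 addn1 !A5.2 //.
          have ph' : var s4 8 < arr s4 6 0 i by move: ph; case: (_ < _).
          have ci' : cls i != c by move: ci; case: (cls i == c).
          apply: (peelingS Pe4) => //; try by lia.
          by move: tJ; case: (_ \in _).
        by rewrite /= h5; lia.
      + move=> s4 A4 [Pe4 le4 T4]; split=> // e y d yd hy dm cy.
        apply: T4 => //; move: yd => /=; lia.
    move=> s3 A3 [Pe3 le3 T3]; apply: wp_assign => /=.
    have -> : var s3 5 = var s2 8 by rewrite A3.1.
    have := peel_card Pe3; have nz : 0 < var s2 12 by case: (var s2 12) go.
    split; last by case: (ltnP (var s2 8) (var s3 8)); lia.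
    split=> //; first by case: (_ < _).
    move=> st y c; rewrite inE => hy cm cy.
    have e : var s3 8 = var s2 8 by move: st; case: ltnP => //; lia.
    have := T3 e y c; rewrite ltn_ord => /(_ isT hy cm cy).
    apply: contra; set S1 := [set _ | _]; suff -> : S1 = tailU1 n fx cls (arr s3 6 0) c (var s3 8) y by [].
    by apply/setP => u; rewrite !inE -val_eqE.
  - by move=> s2 A2 [Pe2 _ st] go; split=> //; apply: st.
rewrite /time_peel; lia.
Qed.

Definition time_shift : nat := n * (n * 3 + 3 + n * (n * 3 + 5) + 11) + 4.

Lemma wp_shift s m h : var s 0 = n -> var s 3 < n -> arr s 4 0 (var s 3) = 0 ->
  (forall y : 'I_n, arr s 4 0 y <= m) ->
  (forall c, 0 < c <= m -> class n (arr s 5) (arr s 4 0) c \in J) ->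
  peeling J (arr s 5) (arr s 4 0) (arr s 6 0) (arr s 7 0) (arr s 8 0) m h ->
  arr s 6 0 (var s 3) <= h ->
  wp O shift_cmd time_shift
    (fun s' => inserted J (arr s 5) (arr s 4 0) (var s 3) m (arr s' 4 0)) s.
Proof.
move=> s0 xn clx clm clJ pe px.
set fx := arr s 5; set cls0 := arr s 4 0; set x := var s 3.
set pos := arr s 6 0; set oc := arr s 7 0; set ord := arr s 8 0.
have hn : h <= n by have := peel_card pe; lia.
apply: wp_time.
  apply/wp_seq/wp_assign/wp_seq/wp_assign.
  (* The position of the displaced element strictly decreases, so there are at most [h <= n]
     exchanges. *)
  apply: (@wp_while n O (fun s' => [/\ var s' 12 <= 1,
      var s' 12 = 1 -> shifting J fx cls0 x pos oc ord m (arr s' 4 0) (var s' 9)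
                        /\ pos (var s' 9) <= h
      & var s' 12 = 0 -> inserted J fx cls0 x m (arr s' 4 0)])
      (fun s' => var s' 12 * pos (var s' 9)) _ n) => //=.
  - by split=> // _; split=> //; apply: shifting0 pe _ _ _ _ _.
  - by rewrite mul1n; apply: leq_trans hn.
  - move=> s1 A1 [go1 sh1 _] go; have {}go1 : var s1 12 = 1 by lia.
    have [sh ph] := sh1 go1; rewrite go1 mul1n.
    set z := var s1 9 in sh ph *; set cls := arr s1 4 0 in sh *.
    have n1 : var s1 0 = n by rewrite A1.1.
    have f1 : arr s1 5 = fx by rewrite A1.2.
    have p1 : arr s1 6 0 = pos by rewrite A1.2.
    have o1 : arr s1 7 0 = oc by rewrite A1.2.
    have r1 : arr s1 8 0 = ord by rewrite A1.2.
    apply/wp_seq/wp_assign/wp_seq/wp_assign/wp_seq.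
    apply: wp_post (wp_test _) _ => //= s2 A2; rewrite p1 f1 o1 -/z -/cls => t2.
    apply/wp_seq; apply: (@wp_while n O (fun s' => [/\
       var s' 11 = (tailU1 n fx cls pos (oc z) (var s' 8) z \in J), var s' 8 < pos z
      & 0 < var s' 8 -> tailU1 n fx cls pos (oc z) (var s' 8).-1 z \notin J])
      (fun s' => pos z - var s' 8) _ n).
    + by rewrite (A2.1 8) //=; split=> //; apply: shift_pos sh.
    + by apply: leq_trans hn; apply: leq_trans ph; apply: leq_subr.
    + move=> s3 A3 [t3 l3 d3]; rewrite /= t3 => nt.
      have {}nt : tailU1 n fx cls pos (oc z) (var s3 8) z \notin J.
        by apply/negP => tJ; move: nt; rewrite tJ.
      apply/wp_seq/wp_assign; apply: wp_post (wp_test _) _ => //=.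
        by rewrite A3.1 //= A2.1.
      move=> s4 A4; rewrite !(A3.1 7) // !(A3.1 9) // !A3.2 // !A2.2 // !(A2.1 7) //= !(A2.1 9) //=.
      rewrite p1 f1 o1 -/z -/cls => t4.
      have v4 : var s4 8 = (var s3 8).+1 by rewrite A4.1 //= addn1.
      rewrite v4 t4 addn1; split; last by lia.
      (* The search stays below [pos z]: the witness of [z] makes the test succeed at [(pos z).-1]
         at the latest. *)
      split=> //; rewrite ltn_neqAle l3 andbT.
      apply: contra nt => /eqP e.
      have := shift_witness sh (j := pos z); rewrite /witness (shift_ord sh) leqnn (shift_pos sh).
      by move=> /(_ isT) [_ _]; rewrite -e.
    + move=> s3 A3 [t3 l3 d3]; rewrite /= t3 => tJ.
      have {}tJ : tailU1 n fx cls pos (oc z) (var s3 8) z \in J.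
        by move: tJ; case: (_ \in J).
      have z3 : var s3 9 = z by rewrite A3.1 //= A2.1.
      have c3 : var s3 7 = oc z by rewrite A3.1 //= A2.1 //= o1.
      have k3 : arr s3 4 0 = cls by rewrite A3.2 //= A2.2.
      have r3 : arr s3 8 0 = ord by rewrite A3.2 //= A2.2.
      have g3 : var s3 12 = 1 by rewrite A3.1 //= A2.1.
      apply/wp_seq/wp_write; rewrite /= z3 c3.
      apply: wp_if => /= g0.
        apply/wp_seq/wp_assign/wp_write => /=; rewrite r3 g3.
        have [||sh' pg] := shift_next matJ pe sh ph _ tJ.
        * by rewrite lt0n g0.
        * by apply: d3; rewrite lt0n.
        have {}pg : pos (ord (var s3 8)) = var s3 8 := pg.
        rewrite pg mul1n; split=> //; split=> // _; split; last by lia.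
        by move: sh'; rewrite -k3.
      apply: wp_assign => /=; rewrite mul0n; split; last exact: shift_pos sh.
      split=> // _; rewrite g0 in tJ; have := shift_last matJ pe sh ph tJ.
      by rewrite -k3.
  - by move=> s1 A1 [_ _ H] /H.
rewrite /time_shift; lia.
Qed.

Definition time_insert m : nat := time_peel m + time_shift + 3.

(** In the second outcome [S] is a Hall obstruction to keeping [m] classes. It justifies the new
    class in the initial coloring and yields a contradiction in a split. *)
Lemma wp_insert s m : var s 0 = n -> var s 3 < n -> arr s 4 0 (var s 3) = 0 ->
  (forall y : 'I_n, arr s 4 0 y <= m) ->
  (forall c, 0 < c <= m -> class n (arr s 5) (arr s 4 0) c \in J) ->
  var s 2 = m ->
  wp O insert_cmd (time_insert m)
    (fun s' => (var s' 2 = m /\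
                inserted J (arr s 5) (arr s 4 0) (var s 3) m (arr s' 4 0)) \/
               (exists S : {set 'I_n}, [/\ forall x : 'I_n, x = var s 3 :> nat -> x \in S,
                  stuck (arr s 5) (arr s 4 0) m S, var s' 2 = m.+1
                & arr s' 4 0 = upd (arr s 4 0) (var s 3) m.+1])) s.
Proof.
move=> s0 xn clx clm clJ sm; apply: wp_time.
  apply/wp_seq; apply: wp_post (wp_peel s0) _ => s1 A1 /=; rewrite sm => -[pe st].
  have x1 : var s1 3 = var s 3 by rewrite A1.1.
  have n1 : var s1 0 = n by rewrite A1.1.
  have k1 : arr s1 4 = arr s 4 by rewrite A1.2.
  have f1 : arr s1 5 = arr s 5 by rewrite A1.2.
  apply: wp_if => /=; rewrite x1 => px.
    apply/wp_seq/wp_assign/wp_write; right.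
    exists [set y : 'I_n | var s1 8 < arr s1 6 0 y]; split=> //=.
    - by move=> y yE; rewrite inE yE; move: px; case: (_ < _).
    - by rewrite A1.1 // sm addn1.
    - by rewrite x1 k1 A1.1 // sm addn1.
  apply: wp_post (wp_shift (m := m) (h := var s1 8) n1 _ _ _ _ _ _) _; rewrite ?x1 ?k1 ?f1 //.
    by move: px; rewrite ltnNge; case: (_ <= _).
  by move=> s2 A2 ins; left; rewrite A2.1 // A1.1.
rewrite /time_insert sm; lia.
Qed.

End Insert.

(** * Optimal coloring of the general matroid *)

(* Further registers.  Variables: 13 round, 14 class t, 15 element, 16 number of
   rounds, 17 partition matroid, 18 counter, 19 blocked flag, 20 loop index,
   21 number of classes of f.
   Arrays: 10 f (0 on colored elements), 11 indicator of I. *)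
Definition init_cmd : cmd :=
  Seq (For 3 (Const 0) (Var 0) insert_cmd)
 (Seq (For 15 (Const 0) (Var 0)
         (Write 10 (Const 0) (Var 15) (Read 4 (Const 0) (Var 15))))
      (Assign 21 (Var 2))).

(** The fixed sets are [I] for class 1 and the elements with [f = t - 1] for class 2; the elements
    with [f = t] are inserted. For [t = 1] only class 1 exists. *)
Definition split_cmd : cmd :=
  Seq (For 15 (Const 0) (Var 0)
        (Seq (Write 4 (Const 0) (Var 15) (Const 0))
        (Seq (Write 5 (Const 1) (Var 15) (Read 11 (Const 0) (Var 15)))
             (Write 5 (Const 2) (Var 15)
               (EqTest (Add (Read 10 (Const 0) (Var 15)) (Const 1)) (Var 14))))))
 (Seq (Assign 2 (Add (Const 1) (LtTest (Const 1) (Var 14))))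
      (For 3 (Const 0) (Var 0)
        (If (EqTest (Read 10 (Const 0) (Var 3)) (Var 14)) insert_cmd Skip))).

Lemma sum_card_fibers (T : finType) (S : {set T}) (h : T -> nat) m :
  \sum_(c < m) #|[set y in S | h y == c]| = \sum_(y in S) (h y < m).
Proof.
have -> : \sum_(c < m) #|[set y in S | h y == c]|
  = \sum_(y in S) \sum_(c < m) (h y == c :> nat).
  rewrite exchange_big /=; apply: eq_bigr => c _.
  rewrite -sum1_card big_mkcond [RHS]big_mkcond /=; apply: eq_bigr => y _.
  by rewrite inE; case: (y \in S) => //=; case: (h y == c).
apply: eq_bigr => y _; have [lt|ge] := ltnP (h y) m.
  rewrite (bigD1 (Ordinal lt)) //= eqxx big1 // => c ne.
  by apply/eqP; rewrite eqb0 eq_sym.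
by rewrite big1 // => c _; apply/eqP; rewrite eqb0; have := ltn_ord c; lia.
Qed.

Lemma card_fibers_le (T : finType) (S : {set T}) (h : T -> nat) m :
  \sum_(c < m) #|[set y in S | h y == c]| <= #|S|.
Proof. by rewrite sum_card_fibers -sum1_card; apply: leq_sum => y _; apply: leq_b1. Qed.

Lemma card_fibers (T : finType) (S : {set T}) (h : T -> nat) m :
  (forall y, y \in S -> h y < m) ->
  #|S| = \sum_(c < m) #|[set y in S | h y == c]|.
Proof.
by move=> hm; rewrite sum_card_fibers -sum1_card; apply: eq_bigr => y /hm ->.
Qed.

Section Coloring.
Variables (n : nat) (J : {set {set 'I_n}}).
Hypothesis matJ : is_matroid J.
Hypothesis colJ : exists c, colorable J c.
Let O : pred {set 'I_n} := fun A => A \in J.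

Lemma colorable_chi : colorable J (chi J).
Proof. by have [c /chiP[]] := colJ. Qed.

Lemma chi_le : chi J <= n.
Proof. by rewrite -[n in _ <= n]card_ord -ltnS ltn_ord. Qed.

Lemma indep1 (x : 'I_n) : [set x] \in J.
Proof.
have /existsP[g /forallP/(_ x) gx] := colorable_chi.
by apply: (indep_sub matJ) gx; rewrite sub1set inE.
Qed.

(** Suppose [chi J <= m]. Inside [S'], the part of [S] treated so far, each class is maximal
    independent, hence at least as large as a color class of an optimal coloring [g]. But the color
    classes of [g] cover [S'], while the classes miss [x]. *)
Lemma stuck_chi (cls : nat -> nat) m (S : {set 'I_n}) (x : 'I_n) fx :
  (forall c y, fx c y = 0) -> (forall c, 0 < c <= m -> class n fx cls c \in J) ->
  stuck J fx cls m S -> x \in S -> (forall y : 'I_n, (cls y == 0) = (x <= y)) ->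
  m < chi J.
Proof.
move=> fx0 clJ st xS cls0; rewrite ltnNge; apply/negP => lem.
have /existsP[g /forallP gP] := colorable_chi.
pose S' := [set y in S | y <= x].
(* Classes are numbered from 1 and fibers from 0; elements of [S' :\ x] have a nonzero class, so the
   predecessor loses nothing. *)
pose A (c : nat) := [set y in S' :\ x | (cls y).-1 == c].
pose B (c : nat) := [set y in S' | (g y : nat) == c].
have xS' : x \in S' by rewrite inE xS leqnn.
have le : \sum_(c < m) #|B c| <= \sum_(c < m) #|A c|.
  apply: leq_sum => c _.
  have AE : A c = [set u : 'I_n | (cls u == c.+1) && (u \in S)].
    apply/setP => u; rewrite !inE -val_eqE /=; have := cls0 u.
    by case: (u \in S) => /=; lia.
  rewrite -[A c]set0U; apply: (@stuck_max _ _ matJ set0 (A c) S').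
  - have cm : 0 < c.+1 <= m by rewrite ltn_ord.
    apply: (indep_sub matJ) (clJ _ cm); rewrite set0U AE.
    by apply/subsetP => u; rewrite !inE => /andP[-> _]; rewrite orbT.
  - move=> y; rewrite inE => /andP[yS yx] yA.
    have cm : 0 < c.+1 <= m by rewrite ltn_ord.
    have cy : cls y != c.+1 by apply: contra yA; rewrite AE inE yS => ->.
    suff -> : y |: (set0 :|: A c) =
      [set u : 'I_n | [|| fx c.+1 u != 0, (cls u == c.+1) && (u \in S) | u == y]].
      exact: st.
    by apply/setP => u; rewrite set0U AE !inE fx0 /= orbC.
  - by apply/subsetP => u; rewrite !inE => /andP[->].
  - have [->|[y]] := set_0Vmem (B c); first by case: matJ.
    rewrite inE => /andP[_ /eqP gy]; apply: (indep_sub matJ) (gP y).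
    by apply/subsetP => u; rewrite !inE -gy => /andP[_ /eqP/val_inj ->].
have lt : \sum_(c < m) #|A c| <= #|S' :\ x| by apply: card_fibers_le.
have E : #|S'| = \sum_(c < m) #|B c|.
  by apply: (card_fibers (h := fun y => g y)) => y _; apply: leq_trans lem.
by have := leq_trans le lt; rewrite -E (cardsD1 x S') xS' add1n ltnn.
Qed.

Definition time_init : nat := n * ((time_insert n n) + 2) + n * 3 + 6.

Lemma time_insert_mono m m' : m <= m' -> time_insert n m <= time_insert n m'.
Proof.
move=> le; rewrite /time_insert /time_peel !leq_add2r leq_mul2l; apply/orP; right.
by rewrite leq_add2r leq_mul2l leq_add2r leq_mul2r le !orbT.
Qed.

Lemma wp_init s : var s 0 = n -> var s 2 = 0 ->
  (forall c y, arr s 5 c y = 0) -> (forall y, arr s 4 0 y = 0) ->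
  wp O init_cmd time_init
    (fun s' => [/\ var s' 21 <= chi J,
       forall y : 'I_n, 0 < arr s' 10 0 y <= var s' 21
     & forall c, 0 < c -> [set y : 'I_n | arr s' 10 0 y == c] \in J]) s.
Proof.
move=> s0 s2 s5 s4; apply: wp_time.
  apply/wp_seq.
  apply: (@wp_for n O (fun i s' => [/\ var s' 2 <= chi J,
     forall y : 'I_n, (arr s' 4 0 y == 0) = (i <= y),
     forall y : 'I_n, arr s' 4 0 y <= var s' 2 &
     forall c, 0 < c <= var s' 2 -> class n (arr s 5) (arr s' 4 0) c \in J]) (time_insert n n) 0 n) => //.
  - by move=> s' A; rewrite /= A.1.
  - rewrite /= s2; split=> //.
    + by move=> y; rewrite s4.
    + by move=> y; rewrite s4.
    + by lia.
  - move=> i s1 A1 iN iE [lchi cls0 clm clJ].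
    have n1 : var s1 0 = n by rewrite A1.1.
    have f1 : arr s1 5 = arr s 5 by rewrite A1.2.
    have c0 : arr s1 4 0 i = 0.
      by apply/eqP; have := cls0 (Ordinal (iN : i < n)); rewrite /= leqnn.
    apply: wp_conseq (wp_insert matJ (m := var s1 2) n1 _ _ clm _ erefl) _ _; rewrite ?iE ?f1 //.
      by apply: time_insert_mono; apply: leq_trans lchi chi_le.
    move=> s2' A2 [[/= -> [z1 z2 z3]]|[S [xS st /= -> ->]]].
      by split=> // y; rewrite z1 cls0; lia.
    pose x := Ordinal (iN : i < n).
    split=> /=.
    (* A class is opened only when stuck, and then fewer than [chi J] classes are in use. *)
    + apply: (stuck_chi (x := x) s5 clJ st) => //; exact: xS.
    + move=> y; rewrite /upd; case: (eqVneq (y : nat) i) => [->|ne]; first by lia.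
      by rewrite cls0; lia.
    + by move=> y; rewrite /upd; case: eqP => // _; apply: leqW; apply: clm.
    + move=> c cm; case: (eqVneq c (var s1 2).+1) => [->|ne].
        apply: (indep_sub matJ) (indep1 x); apply/subsetP => u; rewrite !inE s5 /= /upd.
        rewrite -val_eqE /=; case: (eqVneq (u : nat) i) => //= _.
        by have := clm u; lia.
      have cm' : 0 < c <= var s1 2 by lia.
      apply: (indep_sub matJ) (clJ c cm'); apply/subsetP => u; rewrite !inE s5 /= /upd.
      by case: (eqVneq (u : nat) i) => //= _; lia.
  move=> s1 A1 [lchi cls0 clm clJ].
  apply/wp_seq.
  apply: (@wp_for n O (fun i s' => forall y, y < i -> arr s' 10 0 y = arr s1 4 0 y) 1 0 n) => //.
  - by move=> s' A; rewrite /= A.1 //= A1.1.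
  - move=> i s' A lt iE Inv; apply: wp_write => y /=.
    rewrite iE ltnS leq_eqVlt; case: eqP => [-> _|_ /= /Inv //].
    by rewrite A.2.
  move=> s2' A2 fE; apply: wp_assign => /=; rewrite A2.1 //.
  have clE (y : 'I_n) : 0 < arr s2' 10 0 y <= var s1 2.
    by rewrite fE // clm lt0n cls0 -ltnNge ltn_ord.
  split=> // c c0; have [lec|gtc] := leqP c (var s1 2); last first.
    case: matJ => H _ _; rewrite (_ : [set _ | _] = set0) //.
    by apply/setP => y; rewrite !inE; have := clE y; lia.
  have cm : 0 < c <= var s1 2 by rewrite c0.
  apply: (indep_sub matJ) (clJ c cm); apply/subsetP => u; rewrite !inE fE // => ->.
  by rewrite orbT.
rewrite /time_init; lia.
Qed.

End Coloring.

(** * Splitting a class *)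

Section Split.
Variables (n : nat) (J : {set {set 'I_n}}).
Hypothesis matJ : is_matroid J.
Let O : pred {set 'I_n} := fun A => A \in J.

(** The multiple exchange property in algorithmic form. For [t = 1] the fixed set is empty and all
    subsets of class 1 of [f] are independent. For [t > 1], [stuck_split] with [P = I] and [Q] the
    class [t - 1] would give the two insertion classes at least [#|S'|] elements of [S'], although
    they miss [x]. *)
Lemma split_not_stuck (f inI cls : nat -> nat) t (fx : nat -> nat -> nat) (S : {set 'I_n}) (x : 'I_n) :
  0 < t -> [set y : 'I_n | f y == t] \in J ->
  [set y : 'I_n | (inI y != 0) || (1 < t) && (f y == t.-1)] \in J ->
  (forall y : 'I_n, inI y != 0 -> 1 < t /\ f y = 0) ->
  (forall y : 'I_n, fx 1 y = inI y) ->
  (forall y : 'I_n, fx 2 y = ((f y).+1 == t)) ->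
  (forall y : 'I_n, (cls y == 0) = (f y != t) || (x <= y)) ->
  (forall y : 'I_n, cls y <= 1 + (1 < t)) ->
  (forall c, 0 < c <= 1 + (1 < t) -> class n fx cls c \in J) ->
  f x = t -> x \in S -> stuck J fx cls (1 + (1 < t)) S -> False.
Proof.
move=> t0 AJ IWJ disj fx1 fx2 cls0 clm clJ fxt xS st.
have [t1|t1] := leqP t 1.
  have {}t1 : t = 1 by lia.
  have cx : cls x != 1 by have := cls0 x; rewrite leqnn orbT; lia.
  rewrite t1 in st; move: (st x 1 xS isT cx) => /negP; apply.
  apply: (indep_sub matJ) AJ; apply/subsetP => u; rewrite !inE fx1.
  case/or3P=> [/disj|/andP[/eqP cu _]|/eqP->]; [by lia| |by rewrite fxt].
  by have := cls0 u; rewrite cu; lia.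
rewrite t1 in IWJ clm clJ st; rewrite /= in clm clJ st.
pose S' := [set y in S | (f y == t) && (y <= x)].
pose P := [set y : 'I_n | inI y != 0].
pose Q := [set y : 'I_n | f y == t.-1].
pose A (c : nat) := [set y in S' :\ x | (cls y).-1 == c].
have AE c : A c = [set u : 'I_n | (cls u == c.+1) && (u \in S)].
  apply/setP => u; rewrite !inE -val_eqE /=; have := cls0 u.
  by case: (u \in S) => /=; lia.
have xS' : x \in S' by rewrite !inE xS fxt leqnn eqxx.
have fxQ : [set y : 'I_n | fx 2 y != 0] = Q.
  by apply/setP => u; rewrite !inE fx2; lia.
have fxP : [set y : 'I_n | fx 1 y != 0] = P.
  by apply/setP => u; rewrite !inE fx1.
have clA c : 0 < c.+1 <= 2 -> [set y : 'I_n | fx c.+1 y != 0] :|: A c \in J.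
  move=> c2; apply: (indep_sub matJ) (clJ _ c2); rewrite AE.
  by apply/subsetP => u; rewrite !inE => /orP[->//|/andP[-> _]]; rewrite orbT.
have stA c y : 0 < c.+1 <= 2 -> y \in S' -> y \notin A c ->
    y |: ([set y : 'I_n | fx c.+1 y != 0] :|: A c) \notin J.
  move=> c2; rewrite inE => /andP[yS _] yA.
  have cy : cls y != c.+1 by apply: contra yA; rewrite AE inE yS => ->.
  suff -> : y |: ([set y : 'I_n | fx c.+1 y != 0] :|: A c) =
    [set u : 'I_n | [|| fx c.+1 u != 0, (cls u == c.+1) && (u \in S) | u == y]].
    exact: st.
  by apply/setP => u; rewrite AE !inE orbC orbA.
have le : #|A 0| + #|A 1| <= #|S' :\ x|.
  by have := card_fibers_le (S' :\ x) (fun y => (cls y).-1) 2; rewrite big_ord_recl big_ord1.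
suff lt : #|S'| <= #|A 0| + #|A 1|.
  by have := leq_trans lt le; rewrite (cardsD1 x S') xS' add1n ltnn.
have := @stuck_split _ _ matJ P Q (A 0) (A 1) S'; apply.
- by apply: (indep_sub matJ) IWJ; apply/subsetP => u; rewrite !inE.
- by rewrite -setI_eq0; apply/eqP/setP => u; rewrite !inE; apply/negP => /andP[/disj]; lia.
- by rewrite -setI_eq0; apply/eqP/setP => u; rewrite !inE; apply/negP => /andP[/disj]; lia.
- rewrite -setI_eq0; apply/eqP/setP => u; rewrite !inE; apply/negP.
  by move=> /andP[? /and3P[_ ?]]; lia.
- by apply: (indep_sub matJ) AJ; apply/subsetP => u; rewrite !inE => /and3P[_ ->].
- by rewrite -fxP; apply: clA.
- by rewrite -fxQ; apply: clA.
- by rewrite -fxP => y; apply: stA.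
- by rewrite -fxQ => y; apply: stA.
Qed.

Definition time_split : nat := n * (time_insert n 2 + 4) + n * 5 + 5.

Lemma wp_split s : var s 0 = n -> let f := arr s 10 0 in let t := var s 14 in
  let inI := arr s 11 0 in
  0 < t -> [set y : 'I_n | f y == t] \in J ->
  [set y : 'I_n | (inI y != 0) || (1 < t) && (f y == t.-1)] \in J ->
  (forall y : 'I_n, inI y != 0 -> 1 < t /\ f y = 0) ->
  wp O split_cmd time_split (fun s' => let cls := arr s' 4 0 in
    [/\ forall y : 'I_n, (cls y == 0) = (f y != t),
        forall y : 'I_n, cls y <= 1 + (1 < t),
        [set y : 'I_n | (inI y != 0) || (cls y == 1)] \in J
      & 1 < t -> [set y : 'I_n | (f y == t.-1) || (cls y == 2)] \in J]) s.
Proof.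
move=> s0 f t inI t0 AJ IWJ disj; apply: wp_time.
  apply/wp_seq.
  apply: (@wp_for n O (fun i s' => forall y, y < i -> [/\ arr s' 4 0 y = 0,
     arr s' 5 1 y = inI y & arr s' 5 2 y = ((f y).+1 == t)]) 3 0 n) => //.
  - by move=> s' A; rewrite /= A.1.
  - move=> i s' A lt iE Inv; apply/(@wp_seq _ _ _ _ 1 2)/wp_write/(@wp_seq _ _ _ _ 1 1)/wp_write/wp_write => y /=.
    rewrite iE ltnS leq_eqVlt; case: eqP => [-> _|_ /= /Inv //].
    by split=> //; rewrite ?A.2 // A.1 // addn1.
  move=> s1 A1 I1; apply/wp_seq/wp_assign.
  have n1 : var s1 0 = n by rewrite A1.1.
  have t1 : var s1 14 = t by rewrite A1.1.
  pose fx := arr s1 5.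
  apply: (@wp_for n O (fun i s' => [/\ var s' 2 = 1 + (1 < t),
     forall y : 'I_n, (arr s' 4 0 y == 0) = (f y != t) || (i <= y),
     forall y : 'I_n, arr s' 4 0 y <= 1 + (1 < t) &
     forall c, 0 < c <= 1 + (1 < t) -> class n fx (arr s' 4 0) c \in J]) (time_insert n 2 + 2) 0 n) => //.
  - by move=> s' A; rewrite /= A.1.
  - rewrite /= t1; split=> //.
    + by move=> y; have [-> _ _] := I1 y (ltn_ord y); rewrite orbT.
    + by move=> y; have [-> _ _] := I1 y (ltn_ord y).
    + move=> c cm; apply: (indep_sub matJ) IWJ; apply/subsetP => u; rewrite !inE /fx.
      have [z f1 f2] := I1 u (ltn_ord u); rewrite z.
      have [e|e] : c = 1 \/ c = 2 by lia.
        by rewrite e f1 orbF => ->.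
      by rewrite e f2; lia.
  - move=> i s2 A2 iN iE [m2 cls0 clm clJ].
    have n2 : var s2 0 = n by rewrite A2.1.
    have t2 : var s2 14 = t by rewrite A2.1.
    have f2 : arr s2 10 0 = f by rewrite A2.2 //= A1.2.
    have x2 : arr s2 5 = fx by rewrite A2.2.
    apply: (wp_time (T := (time_insert n 2 + 1).+1)); last by lia.
    apply: wp_if => /=; rewrite iE f2 t2 => fi; last first.
      apply: wp_skip; split=> //= y; rewrite cls0.
      case: (eqVneq (y : nat) i) => [->|ne]; last by lia.
      by move: fi; case: (f i =P t).
    have {}fi : f i = t by move: fi; case: (f i =P t).
    have c0 : arr s2 4 0 i = 0.
      by apply/eqP; have := cls0 (Ordinal (iN : i < n)); rewrite /= leqnn orbT.
    apply: wp_conseq (wp_insert matJ (m := 1 + (1 < t)) n2 _ _ clm _ m2) _ _; rewrite ?iE ?x2 //.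
      by apply: time_insert_mono; case: (1 < t).
    move=> s3 A3 [[/= -> [z1 z2 z3]]|[S [xS st _ _]]].
      split=> // y; rewrite z1 cls0; case: (eqVneq (y : nat) i) => [->|ne]; last by lia.
      by rewrite fi eqxx; lia.
    (* By [split_not_stuck] no further class is ever opened. *)
    exfalso; pose x := Ordinal (iN : i < n).
    apply: (@split_not_stuck f inI (arr s2 4 0) t fx S x) => //.
    + by move=> y; have [] := I1 y (ltn_ord y).
    + by move=> y; have [] := I1 y (ltn_ord y).
    + exact: xS.
  - move=> s2 A2 [_ cls0 clm clJ]; split=> //.
    + by move=> y; rewrite cls0 leqNgt ltn_ord orbF.
    + have : class n fx (arr s2 4 0) 1 \in J by apply: clJ; lia.
      apply: indep_sub => //; apply/subsetP => u; rewrite !inE /fx.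
      by have [_ -> _] := I1 u (ltn_ord u).
    + move=> lt1; have : class n fx (arr s2 4 0) 2 \in J by apply: clJ; rewrite lt1.
      apply: indep_sub => //; apply/subsetP => u; rewrite !inE /fx.
      by have [_ _ ->] := I1 u (ltn_ord u); lia.
rewrite /time_split; lia.
Qed.

End Split.

(** * Selecting the elements that receive the current color *)

Definition block_cmd : cmd :=
  Seq (Assign 19 (Const 0))
      (For 17 (Const 0) (Var 1)
        (Seq (Assign 18 (Const 0))
        (Seq (For 20 (Const 0) (Var 0)
               (If (Read 11 (Const 0) (Var 20))
                   (If (EqTest (Read 0 (Var 17) (Var 20)) (Read 0 (Var 17) (Var 15)))
                       (Assign 18 (Add (Var 18) (Const 1))) Skip)
                   Skip))
             (If (LtTest (Var 18) (Read 1 (Var 17) (Read 0 (Var 17) (Var 15))))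
                 Skip (Assign 19 (Const 1)))))).

(** Label 2 marks [R2], which moves down to class [t - 1]; label 1 marks [R1], scanned greedily. A
    blocked element of [R1] keeps [f = t] and so belongs to the new [W]. *)
Definition select_cmd : cmd :=
  For 15 (Const 0) (Var 0)
    (If (EqTest (Read 4 (Const 0) (Var 15)) (Const 2))
        (Write 10 (Const 0) (Var 15) (Defs.Sub (Var 14) (Const 1)))
        (If (EqTest (Read 4 (Const 0) (Var 15)) (Const 1))
            (Seq block_cmd
                 (If (Var 19) Skip
                     (Seq (Write 11 (Const 0) (Var 15) (Const 1))
                     (Seq (Write 10 (Const 0) (Var 15) (Const 0))
                          (Write 3 (Const 0) (Var 15) (Var 13))))))
            Skip)).

Definition round_cmd : cmd :=
  Seq (For 15 (Const 0) (Var 0) (Write 11 (Const 0) (Var 15) (Const 0)))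
      (For 14 (Const 1) (Add (Var 21) (Const 1)) (Seq split_cmd select_cmd)).

(** The number of rounds, [n + q * n], is computed by repeated addition. It suffices because every
    chromatic number is at most [n]. *)
Definition color_cmd : cmd :=
  Seq init_cmd
 (Seq (Assign 16 (Var 0))
 (Seq (For 17 (Const 0) (Var 1) (Assign 16 (Add (Var 16) (Var 0))))
      (For 13 (Const 0) (Var 16) round_cmd))).

Lemma at_ordE m (f : 'I_m -> nat) (i : 'I_m) : at_ord f i = f i.
Proof. by rewrite /at_ord valK. Qed.

Section Rounds.
Variables (n q : nat) (J : {set {set 'I_n}}) (P : 'I_q -> partition_matroid n).
Hypothesis matJ : is_matroid J.
Let O : pred {set 'I_n} := fun A => A \in J.

Definition own_part i (y : 'I_n) : {set 'I_n} := pm_part (part_of (P i) y).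
Definition own_cap i (y : 'I_n) : nat := capacity (part_of (P i) y).

Definition blocked (I : {set 'I_n}) (y : 'I_n) : bool :=
  [exists i, own_cap i y <= #|I :&: own_part i y|].

Definition input_arrays s := arr s 0 = arr (input_state P) 0 /\
  arr s 1 = arr (input_state P) 1.

Lemma input_part s (i : 'I_q) (y : 'I_n) : input_arrays s ->
  arr s 0 i y = part_of (P i) y.
Proof. by case=> -> _ /=; rewrite !at_ordE. Qed.

Lemma input_cap s (i : 'I_q) (y : 'I_n) : input_arrays s ->
  arr s 1 i (arr s 0 i y) = own_cap i y.
Proof. by move=> ia; rewrite (input_part i y ia); case: ia => _ -> /=; rewrite !at_ordE. Qed.

Lemma blockedS (I I' : {set 'I_n}) y : I \subset I' -> blocked I y -> blocked I' y.
Proof.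
move=> sI /existsP[i le]; apply/existsP; exists i; apply: leq_trans le _.
by apply: subset_leq_card; apply: setSI.
Qed.

Lemma pm_indepU1 (I : {set 'I_n}) y i : ~~ blocked I y -> I \in pm_indep (P i) ->
  y |: I \in pm_indep (P i).
Proof.
rewrite negb_exists => /forallP/(_ i); rewrite -ltnNge => lt.
rewrite !inE => /forallP Ij; apply/forallP => j.
have [e|ne] := eqVneq (part_of (P i) y) j; last first.
  suff -> : (y |: I) :&: pm_part j = I :&: pm_part j by apply: Ij.
  apply/setP => u; rewrite !inE; case: eqP => [->|//]; by rewrite (negbTE ne) !andbF.
move: lt; rewrite /own_cap /own_part e => lt.
rewrite setIUl; apply: leq_trans (leq_card_setU _ _) _.
rewrite -add1n in lt; apply: leq_trans lt; rewrite leq_add2r.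
by apply: leq_trans (subset_leq_card (subsetIl _ _)) _; rewrite cards1.
Qed.

Definition time_block : nat := q * (n * 7 + 9) + 4.

Lemma wp_block s (y : 'I_n) : var s 0 = n -> var s 1 = q -> var s 15 = y ->
  input_arrays s ->
  wp O block_cmd time_block
    (fun s' => (var s' 19 != 0) = blocked [set u : 'I_n | arr s 11 0 u != 0] y) s.
Proof.
move=> s0 s1 s15 ia; set I := [set u : 'I_n | _]; apply: wp_time.
  apply/wp_seq/wp_assign.
  apply: (@wp_for n O (fun i s' => (var s' 19 != 0) =
     [exists j : 'I_q, (j < i) && (own_cap j y <= #|I :&: own_part j y|)]) _ 0 q) => //.
  - by move=> s' A; rewrite /= A.1.
  - by rewrite /=; apply/esym/existsP => -[].
  - move=> i s2 A2 iN iE Inv; pose i' : 'I_q := Ordinal (iN : i < q).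
    have v15 : var s2 15 = y by rewrite A2.1.
    have v0 : var s2 0 = n by rewrite A2.1.
    have ia2 : input_arrays s2 by split; rewrite A2.2 //=; case: ia.
    have e11 : arr s2 11 = arr s 11 by rewrite A2.2.
    apply/wp_seq/wp_assign/wp_seq.
    apply: (@wp_for n O (fun k s' => var s' 18 =
      \sum_(0 <= u < k) ((arr s 11 0 u != 0) && (arr s2 0 i u == arr s2 0 i y))) 5 0 n) => //.
    + by move=> s' A; rewrite /= A.1.
    + by rewrite /= big_geq.
    + move=> k s3 A3 kN kE Inv3; rewrite big_nat_recr //= -Inv3.
      apply: (wp_time (T := (3 + 1).+1)) => //.
      have e3 : arr s3 11 = arr s 11 by rewrite A3.2.
      have e3' : arr s3 0 = arr s2 0 by rewrite A3.2.
      have i3 : var s3 17 = i by rewrite A3.1.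
      have y3 : var s3 15 = y by rewrite A3.1.
      apply: wp_if => /=; rewrite e3 kE => z; last first.
        by apply: wp_skip; rewrite /= z addn0.
      apply: (wp_time (T := (1 + 1).+1)) => //.
      apply: wp_if => /=; rewrite e3' i3 y3 kE => z'; last first.
        by apply: wp_skip; rewrite /= z z' addn0.
      by apply: wp_assign; rewrite /= z; move: z'; case: (_ == arr _ _ _ _).
    + move=> s3 A3 cnt.
      have cE : var s3 18 = #|I :&: own_part i' y|.
        rewrite cnt big_mkord -sum1_card big_mkcond [RHS]big_mkcond /=.
        apply: eq_bigr => u _; rewrite !inE.
        have -> : arr s2 0 i u = part_of (P i') u by apply: (input_part i' u ia2).
        have -> : arr s2 0 i y = part_of (P i') y by apply: (input_part i' y ia2).
        by rewrite val_eqE; case: (_ && _).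
      have capE : arr s3 1 (var s3 17) (arr s3 0 (var s3 17) (var s3 15)) = own_cap i' y.
        rewrite !A3.1 // !A3.2 //= iE v15; exact: (input_cap i' y ia2).
      have v19 : var s3 19 = var s2 19 by rewrite A3.1.
      have recE : [exists j : 'I_q, (j < i.+1) && (own_cap j y <= #|I :&: own_part j y|)]
        = (var s2 19 != 0) || (own_cap i' y <= #|I :&: own_part i' y|).
        rewrite Inv; apply/existsP/orP.
          case=> j /andP[ji cap]; have [e|ne] := eqVneq j i'; first by right; rewrite -e.
          left; apply/existsP; exists j; rewrite cap andbT.
          by move: ne; rewrite -val_eqE /=; lia.
        case=> [/existsP[j /andP[ji cap]]|cap]; first by exists j; rewrite cap andbT leqW.
        by exists i'; rewrite leqnn.
      apply: wp_if => /=; rewrite capE cE => z.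
        apply: wp_skip; rewrite recE /= v19.
        have /negbTE -> : ~~ (own_cap i' y <= #|I :&: own_part i' y|); last by rewrite orbF.
        by rewrite -ltnNge; move: z; case: (_ < _).
      apply: wp_assign; rewrite recE /=; apply/esym/orP; right.
      by rewrite leqNgt; move: z; case: (_ < _).
  - move=> s2 A2 ->; apply: eq_existsb => j; rewrite ltn_ord //.
rewrite /time_block; lia.
Qed.

(** Primed functions are the contents after the scan. Blocking refers to the final [I]; by
    [blockedS] an element once blocked stays so. *)
Definition selected (t r : nat) (cls f inI out f' inI' out' : nat -> nat) (y : 'I_n) : Prop :=
  [/\ cls y = 0 -> [/\ f' y = f y, inI' y = inI y & out' y = out y],
      cls y = 2 -> [/\ f' y = t.-1, inI' y = inI y & out' y = out y]
    & cls y = 1 -> [/\ f' y = 0, inI' y != 0 & out' y = r] \/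
        [/\ f' y = f y, inI' y = inI y, out' y = out y
          & blocked [set u : 'I_n | inI' u != 0] y]].

Definition time_select : nat := n * (time_block + 11) + 2.

Lemma wp_select s : var s 0 = n -> var s 1 = q -> input_arrays s ->
  (forall y : 'I_n, arr s 4 0 y != 0 -> arr s 11 0 y = 0) ->
  (forall i, [set y : 'I_n | arr s 11 0 y != 0] \in pm_indep (P i)) ->
  wp O select_cmd time_select
    (fun s' =>
      (forall y : 'I_n, selected (var s 14) (var s 13) (arr s 4 0)
         (arr s 10 0) (arr s 11 0) (arr s 3 0) (arr s' 10 0) (arr s' 11 0) (arr s' 3 0) y) /\
      (forall i, [set y : 'I_n | arr s' 11 0 y != 0] \in pm_indep (P i))) s.
Proof.
move=> s0 s1 ia inI0 pm; set t := var s 14; set r := var s 13.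
set cls := arr s 4 0; set f := arr s 10 0; set inI := arr s 11 0; set out := arr s 3 0.
apply: wp_time.
  apply: (@wp_for n O (fun i s' =>
    [/\ forall y : 'I_n, y < i ->
          selected t r cls f inI out (arr s' 10 0) (arr s' 11 0) (arr s' 3 0) y,
        forall y : 'I_n, i <= y -> [/\ arr s' 10 0 y = f y, arr s' 11 0 y = inI y
          & arr s' 3 0 y = out y],
        forall i, [set y : 'I_n | arr s' 11 0 y != 0] \in pm_indep (P i)
      & forall y : 'I_n, arr s 4 0 y = 0 -> arr s' 11 0 y = inI y]) _ 0 n) => //.
  - by move=> s' A; rewrite /= A.1.
  - move=> i s2 A2 iN iE [sel rest pm2 same]; pose x : 'I_n := Ordinal (iN : i < n).
    have c2 : arr s2 4 0 = cls by rewrite A2.2.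
    have [fx2 ix2 ox2] := rest x (leqnn _).
    have other (y : 'I_n) : y < i.+1 -> y < i \/ y = x.
      by rewrite ltnS leq_eqVlt => /orP[/eqP e|]; [right; apply: val_inj|left].
    apply: wp_if => /=; rewrite iE c2 => ci.
      have {}ci : cls x = 2 by move: ci; rewrite /=; case: (cls i =P 2).
      apply: wp_write; rewrite /= iE; split=> // y.
      + case/other=> [yi|->]; last first.
          split=> /=; rewrite ci // => _; rewrite eqxx /= subn1 A2.1 //.
        have := sel y yi; rewrite /selected /=.
        by have -> : (y == i :> nat) = false by lia.
      + move=> iy; have -> : (y == i :> nat) = false by lia.
        by apply: rest; lia.
    have nc2 : cls x <> 2 by move=> e; move: ci; rewrite -[i]/(x : nat) e.
    apply: wp_if => /=; rewrite iE c2 => ci'; last first.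
      have c0 : cls x <> 1 by move=> e; move: ci'; rewrite -[i]/(x : nat) e.
      apply: wp_skip; split=> //= y; last by move=> iy; apply: rest; lia.
      by case/other=> [/sel//|->]; split.
    have c1 : cls x = 1 by move: ci'; rewrite /=; case: (cls i =P 1).
    apply/wp_seq.
    have v0 : var s2 0 = n by rewrite A2.1.
    have v1 : var s2 1 = q by rewrite A2.1.
    have ia2 : input_arrays s2 by split; rewrite A2.2 //=; case: ia.
    apply: wp_post (wp_block (y := x) v0 v1 iE ia2) _ => s3 A3 bl.
    have f3 : arr s3 10 = arr s2 10 by rewrite A3.2.
    have i3 : arr s3 11 = arr s2 11 by rewrite A3.2.
    have o3 : arr s3 3 = arr s2 3 by rewrite A3.2.
    apply: wp_if => /= b; last first.
      apply/wp_seq/wp_write/wp_seq/wp_write/wp_write => /=.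
      have -> : var s3 15 = i by rewrite A3.1.
      have -> : var s3 13 = r by rewrite A3.1 // A2.1.
      rewrite f3 i3 o3.
      have nb : ~~ blocked [set u : 'I_n | arr s2 11 0 u != 0] x by rewrite -bl b.
      have setE : [set u : 'I_n | (if u == i :> nat then 1 else arr s2 11 0 u) != 0]
        = x |: [set u : 'I_n | arr s2 11 0 u != 0].
        by apply/setP => u; rewrite !inE -val_eqE /=; case: (eqVneq (u : nat) i).
      split.
      + move=> y /other[yi|->]; last first.
          by split; rewrite /= c1 // => _; left; rewrite eqxx.
        have [h0 h2 h1] := sel y yi; rewrite /selected /=.
        have -> : (y == i :> nat) = false by lia.
        split=> // /h1 [?|[? ? ? bk]]; [by left|right; split=> //].
        by rewrite setE; apply: blockedS bk; apply: subsetUr.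
      + move=> y iy; have -> : (y == i :> nat) = false by lia.
        by apply: rest; lia.
      + by move=> j; rewrite setE; apply: pm_indepU1.
      + move=> y cy; case: eqP => [e|_]; last exact: same.
        by move: c1; rewrite /= -e /cls cy.
    apply: wp_skip; rewrite /= f3 i3 o3; split=> // y.
      case/other=> [/sel//|->]; split; rewrite c1 // => _; right; split=> //.
      by rewrite -bl b.
    by move=> iy; apply: rest; lia.
  - by move=> s2 A2 [sel _ pm2 _]; split=> // y; apply: sel.
rewrite /time_select; lia.
Qed.

End Rounds.

(** * One round *)

Section RoundStep.
Variables (n q : nat) (J : {set {set 'I_n}}) (P : 'I_q -> partition_matroid n).
Hypothesis matJ : is_matroid J.
Let O : pred {set 'I_n} := fun A => A \in J.

Definition picked (inI : nat -> nat) : {set 'I_n} := [set y : 'I_n | inI y != 0].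

(** Compares the contents after scanning classes 1 to [t] with those at the start of the round. A
    lowered element lands in a class already scanned, so it drops only once per round; [1 < f0 y]
    keeps it apart from colored elements. *)
Variant progress (r : nat) (f0 out0 : nat -> nat) t (f inI out : nat -> nat) (y : 'I_n) : Prop :=
| OldColored of f0 y = 0 & f y = 0 & inI y = 0 & out y = out0 y
| NewColored of 0 < f0 y <= t & f y = 0 & inI y != 0 & out y = r
| Lowered of 1 < f0 y <= t & f y = (f0 y).-1 & inI y = 0 & out y = out0 y
| Blocked of 0 < f0 y <= t & f y = f0 y & inI y = 0 & out y = out0 y
    & blocked P (picked inI) y
| Unprocessed of t < f0 y & f y = f0 y & inI y = 0 & out y = out0 y.

(** Right after the scan of class [t] the elements with [f = t] form [W], so [round_picked] is what
    the next split requires. *)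
Record partial_round r f0 out0 t (f inI out : nat -> nat) : Prop := PartialRound {
  round_progress : forall y : 'I_n, progress r f0 out0 t f inI out y;
  round_class : forall c, 0 < c -> [set y : 'I_n | f y == c] \in J;
  round_picked : 0 < t -> [set y : 'I_n | (inI y != 0) || (f y == t)] \in J;
  round_pm : forall i, picked inI \in pm_indep (P i) }.

Lemma partial_round0 r (f0 out0 inI : nat -> nat) : (forall y : 'I_n, inI y = 0) ->
  (forall c, 0 < c -> [set y : 'I_n | f0 y == c] \in J) ->
  partial_round r f0 out0 0 f0 inI out0.
Proof.
move=> inI0 clJ; split=> //.
  move=> y; have [e|lt] := posnP (f0 y); first by apply: OldColored => //.
  exact: Unprocessed.
move=> i; rewrite inE; apply/forallP => j.
by rewrite (_ : picked inI = set0) ?set0I ?cards0 //; apply/setP => y; rewrite !inE inI0.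
Qed.

(** Class [t.+1] becomes the rest of [R1] and, together with the new [I], lies in the old [I + R1].
    Class [t] becomes [W + R2], and the other classes stay as they are. *)
Lemma partial_roundS r f0 out0 t f inI out (cls f' inI' out' : nat -> nat) :
  partial_round r f0 out0 t f inI out ->
  (forall y : 'I_n, (cls y == 0) = (f y != t.+1)) ->
  (forall y : 'I_n, cls y <= 1 + (0 < t)) ->
  [set y : 'I_n | (inI y != 0) || (cls y == 1)] \in J ->
  (0 < t -> [set y : 'I_n | (f y == t) || (cls y == 2)] \in J) ->
  (forall y : 'I_n, selected P t.+1 r cls f inI out f' inI' out' y) ->
  (forall i, picked inI' \in pm_indep (P i)) ->
  partial_round r f0 out0 t.+1 f' inI' out'.
Proof.
move=> [prog clJ _ _] cls0 clm IJ WJ sel pm'.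
have cases (y : 'I_n) : cls y = 0 \/ cls y = 1 \/ (cls y = 2 /\ 0 < t).
  by have := clm y; lia.
have subI : picked inI \subset picked inI'.
  apply/subsetP => y; rewrite !inE => Iy.
  have [h0 _ _] := sel y; have := cls0 y.
  by case: (prog y) => *; try lia; have [|_ -> _] := h0; lia.
split=> //.
- move=> y; have [h0 h2 h1] := sel y; have := cls0 y.
  case: (cases y) => [c|[c|[c t0]]]; rewrite c => /esym fy.
  + have [ef ei eo] := h0 c; rewrite /= in fy.
    case: (prog y) => *.
    * by apply: OldColored; lia.
    * by apply: NewColored; lia.
    * by apply: Lowered; lia.
    * by apply: Blocked; try lia; apply: blockedS subI _.
    * by apply: Unprocessed; lia.
  + have fy' : f y = t.+1 by move: fy => /=; lia.
    have {}prog : [/\ f0 y = t.+1, inI y = 0 & out y = out0 y].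
      by case: (prog y) => *; split; lia.
    case: prog => ? ? ?; case: (h1 c) => [[? ? ?]|[? ? ? ?]].
      by apply: NewColored; lia.
    by apply: Blocked => //; lia.
  + have fy' : f y = t.+1 by move: fy => /=; lia.
    have {}prog : [/\ f0 y = t.+1, inI y = 0 & out y = out0 y].
      by case: (prog y) => *; split; lia.
    by case: prog => ? ? ?; have [? ? ?] := h2 c; apply: Lowered; lia.
- move=> c c0; have [->|nct] := eqVneq c t.+1.
    apply: (indep_sub matJ) IJ; apply/subsetP => y; rewrite !inE => /eqP fy.
    have [h0 h2 h1] := sel y; have := cls0 y.
    case: (cases y) => [e|[e|[e t0]]]; rewrite e ?orbT //.
      by have [? ? ?] := h0 e; lia.
    by have [? ? ?] := h2 e; lia.
  have [ct|nct'] := eqVneq c t.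
    have t0 : 0 < t by rewrite -ct.
    apply: (indep_sub matJ) (WJ t0); apply/subsetP => y; rewrite !inE ct => /eqP fy.
    have [h0 h2 h1] := sel y; have := cls0 y.
    case: (cases y) => [e|[e|[e _]]]; rewrite e ?orbT //.
      by have [? ? ?] := h0 e; lia.
    by case: (h1 e) => [[? ? ?]|[? ? ? ?]]; lia.
  apply: (indep_sub matJ) (clJ c c0); apply/subsetP => y; rewrite !inE => /eqP fy.
  have [h0 h2 h1] := sel y; have := cls0 y.
  case: (cases y) => [e|[e|[e _]]]; rewrite e.
  + by have [? ? ?] := h0 e; lia.
  + by case: (h1 e) => [[? ? ?]|[? ? ? ?]]; lia.
  + by have [? ? ?] := h2 e; lia.
- move=> _; apply: (indep_sub matJ) IJ; apply/subsetP => y; rewrite !inE => H.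
  have [h0 h2 h1] := sel y; have := cls0 y.
  case: (cases y) => [e|[e|[e _]]]; rewrite e ?orbT //.
    by have [? ? ?] := h0 e; lia.
  by have [? ? ?] := h2 e; lia.
Qed.

Definition time_round m : nat := m * (time_split n + time_select n q + 2) + n * 3 + 4.

Lemma wp_round s : var s 0 = n -> var s 1 = q -> input_arrays P s ->
  (forall c, 0 < c -> [set y : 'I_n | arr s 10 0 y == c] \in J) ->
  wp O round_cmd (time_round (var s 21))
    (fun s' => exists inI,
      partial_round (var s 13) (arr s 10 0) (arr s 3 0) (var s 21)
        (arr s' 10 0) inI (arr s' 3 0)) s.
Proof.
move=> s0 s1 ia clJ; apply: wp_time.
  apply/wp_seq.
  apply: (@wp_for n O (fun i s' => forall y, y < i -> arr s' 11 0 y = 0) 1 0 n) => //.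
  - by move=> s' A; rewrite /= A.1.
  - move=> i s' A lt iE Inv; apply: wp_write => y /=.
    by rewrite iE ltnS leq_eqVlt; case: eqP => [-> _|_ /= /Inv //].
  move=> s2 A2 inI0.
  apply: (@wp_for n O (fun i s' => partial_round (var s 13) (arr s 10 0) (arr s 3 0) i.-1
     (arr s' 10 0) (arr s' 11 0) (arr s' 3 0)) (time_split n + time_select n q) 1 (var s 21).+1) => //.
  - by move=> s' A; rewrite /= A.1 //= A2.1 //= addn1.
  - rewrite /= (A2.2 10) // (A2.2 3) //; apply: partial_round0 => // y; exact: inI0.
  - case=> // t s3 A3 tN tE; rewrite /= => pr; apply: wp_seq.
    have v0 : var s3 0 = n by rewrite A3.1 //= A2.1.
    have v1 : var s3 1 = q by rewrite A3.1 //= A2.1.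
    have v13 : var s3 13 = var s 13 by rewrite A3.1 //= A2.1.
    have ia3 : input_arrays P s3 by split; rewrite A3.2 //= A2.2 //=; case: ia.
    have disj (y : 'I_n) : arr s3 11 0 y != 0 -> 0 < t /\ arr s3 10 0 y = 0.
      by case: (round_progress pr y) => *; lia.
    apply: wp_post (wp_split matJ v0 _ _ _ _) _; rewrite ?tE //=.
    + exact: (round_class pr).
    (* Before class 1 is scanned [I] is empty and there is no [W]. *)
    + have [t0|t0] := posnP t.
        case: matJ => H _ _; rewrite (_ : [set _ | _] = set0) //.
        apply/setP => y; rewrite !inE t0 /= orbF.
        by apply/negbTE/negP => /disj; rewrite t0; case.
      apply: (indep_sub matJ) (round_picked pr t0); apply/subsetP => y.
      by rewrite !inE ltnS t0.
    + move=> s4 A4 [cls0 clm IJ WJ].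
      have v40 : var s4 0 = n by rewrite A4.1.
      have v41 : var s4 1 = q by rewrite A4.1.
      have ia4 : input_arrays P s4 by split; rewrite A4.2 //=; case: ia3.
      have e10 : arr s4 10 = arr s3 10 by rewrite A4.2.
      have e11 : arr s4 11 = arr s3 11 by rewrite A4.2.
      have e3 : arr s4 3 = arr s3 3 by rewrite A4.2.
      have e14 : var s4 14 = t.+1 by rewrite A4.1.
      have e13 : var s4 13 = var s 13 by rewrite A4.1.
      apply: wp_post (wp_select J v40 v41 ia4 _ _) _.
      * move=> y; rewrite cls0 negbK e11 => /eqP fy; apply/eqP; apply: contraT.
        by move=> /disj [_]; rewrite fy.
      * by rewrite e11; apply: (round_pm pr).
      * move=> s5 A5; rewrite e10 e11 e3 e14 e13 => -[sel pm] /=.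
        exact: partial_roundS pr cls0 clm IJ WJ sel pm.
  - by move=> s3 A3 pr; exists (arr s3 11 0).
rewrite /time_round; lia.
Qed.

End RoundStep.

(** * The number of rounds *)

Lemma pm_indep_sub n (M : partition_matroid n) (A B : {set 'I_n}) :
  A \subset B -> B \in pm_indep M -> A \in pm_indep M.
Proof.
move=> sAB; rewrite !inE => /forallP Bj; apply/forallP => j.
by apply: leq_trans (Bj j); apply: subset_leq_card; apply: setSI.
Qed.

Lemma pm_indep0 n (M : partition_matroid n) : set0 \in pm_indep M.
Proof. by rewrite inE; apply/forallP => j; rewrite set0I cards0. Qed.

Lemma pm_colorable n (M : partition_matroid n) : colorable (pm_indep M) n.
Proof.
apply/existsP; exists [ffun x => x]; apply/forallP => x; rewrite inE; apply/forallP => j.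
apply: leq_trans (capacity_gt0 j); rewrite -(cards1 x); apply: subset_leq_card.
by apply/subsetP => y; rewrite !inE !ffunE => /andP[].
Qed.

(** Each of the [chi] color classes meets the part in at most [capacity j] elements. *)
Lemma card_pm_part n (M : partition_matroid n) (j : 'I_(nparts M)) :
  #|pm_part j| <= chi (pm_indep M) * capacity j.
Proof.
have [/existsP[g /forallP gP] _] := chiP (pm_colorable M).
rewrite (@card_fibers _ _ (fun y => g y) (chi (pm_indep M))) //.
rewrite -[X in _ <= X * _]card_ord -sum_nat_const; apply: leq_sum => c _.
have [->|[y]] := set_0Vmem [set y in pm_part j | (g y : nat) == c]; first by rewrite cards0.
rewrite inE => /andP[_ /eqP gy]; have := gP y; rewrite inE => /forallP/(_ j).
apply: leq_trans; apply: subset_leq_card; apply/subsetP => u; rewrite !inE.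
by move=> /andP[-> /eqP gu]; rewrite andbT -val_eqE /= gu gy.
Qed.

(** * Saturation counts and the bound on the colors *)

Section Main.
Variables (n q : nat) (J : {set {set 'I_n}}) (P : 'I_q -> partition_matroid n).
Hypothesis matJ : is_matroid J.
Hypothesis colJ : exists c, colorable J c.
Let O : pred {set 'I_n} := fun A => A \in J.

Definition color_bound : nat := 1 + \sum_(i < q.+1) (chi (systems J P i) - 1).

Lemma color_boundE :
  color_bound = 1 + (chi J - 1) + \sum_(i < q) (chi (pm_indep (P i)) - 1).
Proof.
rewrite /color_bound big_ord_recl addnA /systems unlift_none; congr (_ + _).
by apply: eq_bigr => i _; rewrite liftK.
Qed.

Definition colored (f : nat -> nat) : {set 'I_n} := [set u : 'I_n | f u == 0].

(** The uncolored [y] lies in its own part, so fewer than [chi] times the capacity of its elements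
    are colored. *)
Lemma quota_le (C : {set 'I_n}) i (y : 'I_n) : y \notin C ->
  #|C :&: own_part P i y| %/ own_cap P i y <= chi (pm_indep (P i)) - 1.
Proof.
move=> yC; have cap0 : 0 < own_cap P i y by apply: capacity_gt0.
suff : #|C :&: own_part P i y| %/ own_cap P i y < chi (pm_indep (P i)) by lia.
rewrite ltn_divLR //; apply: leq_trans (card_pm_part (part_of (P i) y)).
apply: proper_card; apply/properP; split; first exact: subsetIr.
by exists y; rewrite !inE ?eqxx // (negbTE yC).
Qed.

(* In [inv_wait] the i-th summand bounds from above the number of rounds in which
   the part of y in the i-th partition matroid was saturated. *)
Record invariant m r (f out : nat -> nat) : Prop := Invariant {
  inv_le : forall y : 'I_n, f y <= m;
  inv_class : forall c, 0 < c -> [set y : 'I_n | f y == c] \in J;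
  inv_indep : forall l, [set y in colored f | out y == l] \in J;
  inv_pm : forall l i, [set y in colored f | out y == l] \in pm_indep (P i);
  inv_out : forall y : 'I_n, f y = 0 -> out y < r;
  inv_bound : forall y : 'I_n, f y = 0 -> out y < color_bound;
  inv_wait : forall y : 'I_n, f y != 0 ->
    r + f y <= m + \sum_(i < q) #|colored f :&: own_part P i y| %/ own_cap P i y }.

(** As [f y] is still at least 1, at most [chi J - 1] rounds lowered it, and by [quota_le] at most
    [chi - 1] rounds are charged to each partition matroid. *)
Lemma wait_bound m r f out (y : 'I_n) : m <= chi J -> invariant m r f out ->
  f y != 0 -> r < color_bound.
Proof.
move=> lem inv fy; have := inv_wait inv fy.
have le : \sum_(i < q) #|colored f :&: own_part P i y| %/ own_cap P i y <=
  \sum_(i < q) (chi (pm_indep (P i)) - 1).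
  by apply: leq_sum => i _; apply: quota_le; rewrite inE.
have := inv_le inv y; rewrite color_boundE.
move: le; set S1 := \sum_(i < q) _; set S2 := \sum_(i < q) _; lia.
Qed.

(** Every element left uncolored is charged: either [f] drops by one, or a partition matroid blocks
    it and the corresponding quotient grows. Color [r] goes to a subset of [I] only. *)
Lemma invariantS m r f out f' inI out' : m <= chi J -> invariant m r f out ->
  partial_round J P r f out m f' inI out' -> invariant m r.+1 f' out'.
Proof.
move=> lem inv pr; have prog := round_progress pr; have fm := inv_le inv.
have sC : colored f \subset colored f'.
  by apply/subsetP => y; rewrite !inE => /eqP fy; case: (prog y); lia.
have sI : picked n inI \subset colored f'.
  by apply/subsetP => y; rewrite !inE => Iy; case: (prog y); lia.
have dCI : [disjoint colored f & picked n inI].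
  rewrite -setI_eq0; apply/eqP/setP => y; rewrite !inE; apply/negP.
  by case/andP=> /eqP ? ?; case: (prog y); lia.
have oldl l : l != r -> [set y in colored f' | out' y == l] \subset
    [set y in colored f | out y == l].
  move=> lr; apply/subsetP => y; rewrite !inE => /andP[/eqP f'0 /eqP ol].
  by case: (prog y) => *; lia.
(* Older colors are below [r] by [inv_out]. *)
have newl : [set y in colored f' | out' y == r] \subset picked n inI.
  apply/subsetP => y; rewrite !inE => /andP[/eqP f'0 /eqP ol].
  case: (prog y) => *; try lia.
  by have := inv_out inv (y := y); lia.
split.
- by move=> y; case: (prog y) => *; have := fm y; lia.
- exact: (round_class pr).
- move=> l; have [->|lr] := eqVneq l r; last first.
    by apply: (indep_sub matJ) (oldl l lr) (inv_indep inv l).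
  (* For [m = 0] nothing was uncolored, so [I] is empty. *)
  have [m0|m0] := posnP m.
    case: matJ => H _ _; rewrite (_ : [set _ in _ | _] = set0) //.
    apply/eqP; rewrite -subset0; apply: subset_trans newl _.
    by apply/subsetP => y; rewrite !inE => Iy; case: (prog y); lia.
  apply: (indep_sub matJ) (round_picked pr m0); apply: subset_trans newl _.
  by apply/subsetP => y; rewrite !inE => ->.
- move=> l i; have [->|lr] := eqVneq l r; last first.
    by apply: pm_indep_sub (oldl l lr) (inv_pm inv l i).
  exact: pm_indep_sub newl (round_pm pr i).
- by move=> y f'0; case: (prog y) => *; try lia; have := inv_out inv (y := y); lia.
- move=> y f'0; case: (prog y) => *; try lia.
    by have := inv_bound inv (y := y); lia.
  have fy : f y != 0 by lia.
  by have := wait_bound lem inv fy; lia.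
- move=> y f'y; have fy : f y != 0 by case: (prog y) => *; lia.
  have := inv_wait inv fy.
  have le i : #|colored f :&: own_part P i y| %/ own_cap P i y <=
     #|colored f' :&: own_part P i y| %/ own_cap P i y.
    by apply: leq_div2r; apply: subset_leq_card; apply: setSI.
  have [low|[-> /existsP[i cap]]] :
      f' y = (f y).-1 \/ (f' y = f y /\ blocked P (picked n inI) y).
    by have := fm y; case: (prog y) => *; [lia|lia|left|right|lia].
  + have : \sum_(i < q) #|colored f :&: own_part P i y| %/ own_cap P i y <=
       \sum_(i < q) #|colored f' :&: own_part P i y| %/ own_cap P i y by apply: leq_sum.
    by set S1 := \sum_(i < q) _; set S2 := \sum_(i < q) _; lia.
  suff : \sum_(i < q) #|colored f :&: own_part P i y| %/ own_cap P i y <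
     \sum_(i < q) #|colored f' :&: own_part P i y| %/ own_cap P i y.
    by set S1 := \sum_(i < q) _; set S2 := \sum_(i < q) _; lia.
  rewrite (bigD1 i) //= [X in _ < X](bigD1 i) //= -addSn; apply: leq_add; last first.
    by apply: leq_sum.
  have cap0 : 0 < own_cap P i y by apply: capacity_gt0.
  (* [I] adds at least a full capacity of elements to the part, disjoint from those colored before,
     so the quotient rises by at least one. *)
  have divS a : (a %/ own_cap P i y).+1 = (own_cap P i y + a) %/ own_cap P i y.
    by rewrite divnDl ?dvdnn // divnn cap0 add1n.
  rewrite divS; apply: leq_div2r; rewrite addnC; apply: leq_trans (leq_add (leqnn _) cap) _.
  rewrite -cardsUI [X in _ + X](_ : _ = 0) ?addn0.
    by apply: subset_leq_card; rewrite -setIUl; apply: setSI; rewrite subUset sC.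
  apply/eqP; rewrite cards_eq0 -subset0 -(disjoint_setI0 dCI) setIACA.
  exact: subsetIl.
Qed.
Lemma invariant0 m (f out : nat -> nat) : (forall y : 'I_n, 0 < f y <= m) ->
  (forall c, 0 < c -> [set y : 'I_n | f y == c] \in J) -> invariant m 0 f out.
Proof.
move=> fm clJ; have c0 l : [set y in colored f | out y == l] = set0.
  by apply/setP => y; rewrite !inE; have := fm y; lia.
split=> //.
- by move=> y; have := fm y; lia.
- by move=> l; rewrite c0; case: matJ.
- by move=> l i; rewrite c0; apply: pm_indep0.
- by move=> y; have := fm y; lia.
- by move=> y; have := fm y; lia.
- by move=> y _; have := fm y; move: (\sum_(i < q) _) => S; lia.
Qed.

(** For [n = 0] the left side would be 1 and the right side 0. *)
Lemma color_bound_le : 0 < n -> color_bound <= n + q * n.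
Proof.
move=> n0; rewrite color_boundE; apply: leq_add.
  by have := chi_le J; lia.
rewrite -[q in q * n]card_ord -sum_nat_const; apply: leq_sum => i _.
by have := chi_le (pm_indep (P i)); lia.
Qed.

(** An element uncolored after [n + q * n] rounds would contradict [wait_bound] and
    [color_bound_le]. *)
Lemma invariant_coloring m (f out : nat -> nat) : m <= chi J ->
  invariant m (n + q * n) f out ->
  is_coloring (\bigcap_(i < q.+1) systems J P i) (fun y : 'I_n => out y) /\
  num_colors (fun y : 'I_n => out y) <= color_bound.
Proof.
move=> lem inv; have f0 (y : 'I_n) : f y = 0.
  apply/eqP; apply: contraT => fy; have := wait_bound lem inv fy.
  by have := ltn_ord y => lt; rewrite ltnNge color_bound_le //; lia.
have cE (y : 'I_n) : [set u : 'I_n | out u == out y] = [set u in colored f | out u == out y].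
  by apply/setP => u; rewrite !inE f0.
split.
  apply/forallP => y; rewrite cE; apply/bigcapP => i _; rewrite /systems.
  by case: unliftP => [j _|_]; [apply: (inv_pm inv)|apply: (inv_indep inv)].
rewrite /num_colors -[X in _ <= X](size_iota 0); apply: uniq_leq_size (undup_uniq _) _.
move=> l; rewrite mem_undup => /codomP[y ->]; rewrite mem_iota /= add0n.
exact: (inv_bound inv).
Qed.

Definition time_color : nat :=
  time_init n + (q * 3 + 2) + (n + q * n) * (time_round n q n + 2) + 3.

Lemma wp_color : wp O color_cmd time_color
  (fun s => exists2 m, m <= chi J & invariant m (n + q * n) (arr s 10 0) (arr s 3 0))
  (input_state P).
Proof.
apply: wp_time.
  apply/wp_seq; apply: wp_post (wp_init matJ colJ _ _ _ _) _ => //.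
  move=> s1 A1 [lem fm clJ]; set m := var s1 21 in lem fm.
  have v0 : var s1 0 = n by rewrite A1.1.
  have v1 : var s1 1 = q by rewrite A1.1.
  have a0 : arr s1 0 = arr (input_state P) 0 by rewrite A1.2.
  have a1 : arr s1 1 = arr (input_state P) 1 by rewrite A1.2.
  apply/wp_seq/wp_assign/wp_seq.
  apply: (@wp_for n O (fun i s' => var s' 16 = n + i * n) 1 0 q) => //.
  - by move=> s' A; rewrite /= A.1.
  - by rewrite /= v0 mul0n addn0.
  - move=> i s2 A2 iN iE H; apply: wp_assign; rewrite /= H A2.1 //= v0 mulSn; lia.
  move=> s2 A2 R2.
  apply: (@wp_for n O (fun i s' => invariant m i (arr s' 10 0) (arr s' 3 0))
            (time_round n q n) 0 (n + q * n)) => //.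
  - by move=> s' A; rewrite /= A.1.
  - by rewrite /= !A2.2 //=; apply: invariant0.
  - move=> i s3 A3 iN iE inv.
    have w0 : var s3 0 = n by rewrite A3.1 //= A2.1.
    have w1 : var s3 1 = q by rewrite A3.1 //= A2.1.
    have w21 : var s3 21 = m by rewrite A3.1 //= A2.1.
    have ia : input_arrays P s3 by split; rewrite A3.2 //= A2.2.
    apply: wp_conseq (wp_round matJ w0 w1 ia (inv_class inv)) _ _.
      rewrite w21 /time_round !leq_add2r leq_mul2r; apply/orP; right.
      exact: leq_trans lem (chi_le J).
    by move=> s4 A4 [inI]; rewrite iE w21 => /= /(invariantS lem inv).
  - by move=> s3 A3 inv; exists m.
rewrite /time_color subn0; lia.
Qed.

End Main.

(** * Polynomial running time and conclusion *)

Definition poly_bounded (F : nat -> nat -> nat) : Prop :=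
  exists p : {poly nat}, forall n q, F n q <= (p.[n + q])%R.

Lemma poly_bounded_const c : poly_bounded (fun _ _ => c).
Proof. by exists (c%:P)%R => n q; rewrite hornerC. Qed.

Lemma poly_bounded_fst : poly_bounded (fun n _ => n).
Proof. by exists 'X%R => n q; rewrite hornerX leq_addr. Qed.

Lemma poly_bounded_snd : poly_bounded (fun _ q => q).
Proof. by exists 'X%R => n q; rewrite hornerX leq_addl. Qed.

Lemma poly_bounded_add F G : poly_bounded F -> poly_bounded G ->
  poly_bounded (fun n q => F n q + G n q).
Proof.
move=> [p pP] [r rP]; exists (p + r)%R => n q; rewrite hornerD.
exact: leq_add (pP n q) (rP n q).
Qed.

Lemma poly_bounded_mul F G : poly_bounded F -> poly_bounded G ->
  poly_bounded (fun n q => F n q * G n q).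
Proof.
move=> [p pP] [r rP]; exists (p * r)%R => n q; rewrite hornerM.
exact: leq_mul (pP n q) (rP n q).
Qed.

Lemma horner_nat_mono (p : {poly nat}) a b : a <= b -> (p.[a])%R <= (p.[b])%R.
Proof.
move=> le; elim/poly_ind: p => [|p c IHp]; first by rewrite !horner0.
rewrite !hornerMXaddC; apply: leq_add => //; exact: leq_mul.
Qed.

(** The bound is built from constants, [n] and [q] by sums and products. *)
Lemma poly_bounded_time_color : poly_bounded time_color.
Proof.
rewrite /time_color /time_init /time_round /time_split /time_select /time_block.
rewrite /time_insert /time_peel /time_shift.
repeat first [apply: poly_bounded_const | apply: poly_bounded_fst
  | apply: poly_bounded_snd | apply: poly_bounded_add | apply: poly_bounded_mul].
Qed.

(** [alg] and [p] are fixed before the instance. Colorability of [I1] gives [chi I1] its meaning;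
    partition matroids are colorable because capacities are positive. *)
Theorem theorem1p4 :
  exists (alg : cmd) (p : {poly nat}),
    forall (n q : nat) (I1 : {set {set 'I_n}}) (P : 'I_q -> partition_matroid n),
      is_matroid I1 ->
      (exists c, colorable I1 c) ->
      exists (s : state) (t : nat),
        [/\ exec (fun A : {set 'I_n} => A \in I1) alg (input_state P) s t,
            t <= (p.[input_size P])%R,
            is_coloring (\bigcap_(i < q.+1) systems I1 P i) (@output_coloring n s)
          & num_colors (@output_coloring n s)
              <= 1 + \sum_(i < q.+1) (chi (systems I1 P i) - 1)].
Proof.
have [p pP] := poly_bounded_time_color; exists color_cmd, p => n q I1 P matI colI.
have [s [t [ex le [m lem inv]]]] := wp_color P matI colI.
have [col num] := invariant_coloring lem inv.
exists s, t; split=> //; apply: leq_trans le _; apply: leq_trans (pP n q) _.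
by apply: horner_nat_mono; rewrite /input_size leq_addr.
Qed.
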